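(* Choose any sequence $\{a_n\}_{n\in\mathbb{Z}}$ in $\mathbb{H}$. Let $R_1,R_2\in[0,+\infty]$ be such that $R_1=\limsup_{m\to+\infty}|a_{-m}|^{1/m}$ and $1/R_2=\limsup_{n\to+\infty}|a_n|^{1/n}$. For all $p\in\mathbb{H}$ the series $$f(q)=\sum_{n\in\mathbb{Z}}(q-p)^{*n}a_n$$ converges absolutely and uniformly on the compact subsets of $\Sigma(p,R_1,R_2)$, and it does not converge at any point of $T(p,R_1)$ nor at any point of $\mathbb{H}\setminus\overline{\Sigma(p,R_2)}$. Furthermore, if $\Omega(p,R_1,R_2)\neq\emptyset$ then the sum of the series defines a regular function $f:\Omega(p,R_1,R_2)\to\mathbb{H}$.
   Context: $\mathbb{H}$ denotes the quaternions, $\mathbb{S}=\{q\in\mathbb{H}:q^2=-1\}$, $x+y\mathbb{S}=\{x+Jy:J\in\mathbb{S}\}$. A function $f$ on an open set $\Omega\subseteq\mathbb{H}$ is regular if for all $I\in\mathbb{S}$ its restriction $f_I$ to $\Omega\cap(\mathbb{R}+I\mathbb{R})$ has continuous partial derivatives and $\frac12\left(\frac{\partial}{\partial x}+I\frac{\partial}{\partial y}\right)f_I(x+Iy)\equiv0$. For $p\in\mathbb{R}+I\mathbb{R}$ and $n\in\mathbb{N}$, $(q-p)^{*n}$ is the $n$-th power of $q\mapsto q-p$ for the product of polynomials $\left(\sum q^ka_k\right)*\left(\sum q^kb_k\right)=\sum_kq^k\sum_{l=0}^ka_lb_{k-l}$; it is the unique regular function on $\mathbb{H}$ whose restriction to $\mathbb{R}+I\mathbb{R}$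 is $(z-p)^n$. For $m\in\mathbb{N}$ and $p=x+Iy$, $(q-p)^{*(-m)}=(q-p)^{-*m}=\left[(q-x)^2+y^2\right]^{-m}(q-\bar p)^{*m}$ on $\mathbb{H}\setminus(x+y\mathbb{S})$ (the regular reciprocal of $(q-p)^{*m}$), the unique regular function there whose restriction to $\mathbb{R}+I\mathbb{R}$ is $(z-p)^{-m}$; if $p\notin\mathbb{R}$, at $q=\bar p$ it is given the value $(\bar p-p)^{-m}$. At the remaining points of $x+y\mathbb{S}$ it is undefined for $m>0$, and a series containing infinitely many nonzero terms of this kind is regarded as not convergent there. $\sigma(q,p)=\tau(q,p)=|q-p|$ if $p,q$ lie on the same complex line $\mathbb{R}+I\mathbb{R}$ for some $I\in\mathbb{S}$; otherwise $\sigma(q,p)=\omega(q,p)$ and $\tau(q,p)=\sqrt{(\mathrm{Re}\,q-\mathrm{Re}\,p)^2+(|\mathrm{Im}\,q|-|\mathrm{Im}\,p|)^2}$, where for all $p,q$ $$\omega(q,p)=\sqrt{(\mathrm{Re}\,q-\mathrm{Re}\,p)^2+(|\mathrm{Im}\,q|+|\mathrm{Im}\,p|)^2}.$$ Set $\Sigma(p,R)=\{q:\sigma(q,p)<R\}$, whose Euclidean closure is $\overline{\Sigma(p,R)}=\{q:\sigma(q,p)\le R\}$; $\Omega(p,R)=\{q:\omega(q,p)<R\}$; $T(p,R)=\{q:\tau(q,p)<R\}$, whose closure is given by $\overline{T(p,R)}=\bigcup_{J\in\mathbb{S}}\overline{\Delta_J(x+Jy,R)}$ for $p=x+Iy$,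 where $\overline{\Delta_J(c,R)}=\{z\in\mathbb{R}+J\mathbb{R}:|z-c|\le R\}$ (this formula is also used as the meaning of $\overline{T(p,R)}$ when $R=0$). Finally $$\Sigma(p,R_1,R_2)=\{q\in\mathbb{H}:\tau(q,p)>R_1,\ \sigma(q,p)<R_2\},\qquad\Omega(p,R_1,R_2)=\Omega(p,R_2)\setminus\overline{T(p,R_1)},$$ the latter being the Euclidean interior of the former.
   Formalization: Uniform convergence is claimed on subsets of Σ(p,R1,R2) compact for the topology of the distance σ, and on Euclidean compact subsets of Ω(p,R1,R2); it can fail on Euclidean compact subsets of Σ(p,R1,R2) that leave Ω(p,R1,R2). *)

(* Defs.v *)
From HB Require Import structures.
From mathcomp Require Import all_boot all_order all_algebra.
From mathcomp Require Import ring lra.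
From mathcomp Require Import all_classical all_reals all_analysis.

Set Implicit Arguments.
Unset Strict Implicit.
Unset Printing Implicit Defensive.

Import Order.TTheory GRing.Theory Num.Theory.
Import numFieldNormedType.Exports.

Local Open Scope classical_set_scope.
Local Open Scope ring_scope.

(** * Quaternions over a real type, as a normed division algebra *)

Record quat (R : realType) :=
  Quat { qr : R ; qi : R ; qj : R ; qk : R }.

HB.instance Definition _ (R : realType) := gen_eqMixin (quat R).
HB.instance Definition _ (R : realType) := gen_choiceMixin (quat R).

Section QuatAlgebra.
Variable R : realType.
Implicit Types (k : R) (p q r : quat R).

Definition qzero : quat R := Quat 0 0 0 0.
Definition qone : quat R := Quat 1 0 0 0.
Definition qopp p := Quat (- qr p) (- qi p) (- qj p) (- qk p).
Definition qadd p q :=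
  Quat (qr p + qr q) (qi p + qi q) (qj p + qj q) (qk p + qk q).
Definition qscale k p := Quat (k * qr p) (k * qi p) (k * qj p) (k * qk p).
Definition qmul p q := Quat
  (qr p * qr q - qi p * qi q - qj p * qj q - qk p * qk q)
  (qr p * qi q + qi p * qr q + qj p * qk q - qk p * qj q)
  (qr p * qj q - qi p * qk q + qj p * qr q + qk p * qi q)
  (qr p * qk q + qi p * qj q - qj p * qi q + qk p * qr q).
Definition qconj p := Quat (qr p) (- qi p) (- qj p) (- qk p).
Definition qsqnorm p := qr p ^+ 2 + qi p ^+ 2 + qj p ^+ 2 + qk p ^+ 2.
Definition qinv p := qscale (qsqnorm p)^-1 (qconj p).
Definition qnorm p := Num.sqrt (qsqnorm p).

Lemma qaddA : associative qadd.
Proof. by move=> [? ? ? ?] [? ? ? ?] [? ? ? ?]; rewrite /qadd /=; congr Quat; ring. Qed.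

Lemma qaddC : commutative qadd.
Proof. by move=> [? ? ? ?] [? ? ? ?]; rewrite /qadd /=; congr Quat; ring. Qed.

Lemma qadd0 : left_id qzero qadd.
Proof. by move=> [? ? ? ?]; rewrite /qadd /=; congr Quat; ring. Qed.

Lemma qaddN : left_inverse qzero qopp qadd.
Proof. by move=> [? ? ? ?]; rewrite /qadd /qopp /qzero /=; congr Quat; ring. Qed.

HB.instance Definition _ := GRing.isZmodule.Build (quat R) qaddA qaddC qadd0 qaddN.

Lemma qmulA : associative qmul.
Proof. by move=> [? ? ? ?] [? ? ? ?] [? ? ? ?]; rewrite /qmul /=; congr Quat; ring. Qed.

Lemma qmul1l : left_id qone qmul.
Proof. by move=> [? ? ? ?]; rewrite /qmul /=; congr Quat; ring. Qed.

Lemma qmul1r : right_id qone qmul.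
Proof. by move=> [? ? ? ?]; rewrite /qmul /=; congr Quat; ring. Qed.

Lemma qmulDl : left_distributive qmul qadd.
Proof. by move=> [? ? ? ?] [? ? ? ?] [? ? ? ?]; rewrite /qmul /qadd /=; congr Quat; ring. Qed.

Lemma qmulDr : right_distributive qmul qadd.
Proof. by move=> [? ? ? ?] [? ? ? ?] [? ? ? ?]; rewrite /qmul /qadd /=; congr Quat; ring. Qed.

Lemma qone_neq0 : qone != qzero.
Proof. by apply/eqP => -[] /eqP; rewrite oner_eq0. Qed.

HB.instance Definition _ := GRing.Zmodule_isNzRing.Build (quat R)
  qmulA qmul1l qmul1r qmulDl qmulDr qone_neq0.

Lemma qscaleA k l p : qscale k (qscale l p) = qscale (k * l) p.
Proof. by case: p => *; rewrite /qscale /=; congr Quat; ring. Qed.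

Lemma qscale1 : left_id 1 qscale.
Proof. by move=> [? ? ? ?]; rewrite /qscale /=; congr Quat; ring. Qed.

Lemma qscaleDr : right_distributive qscale +%R.
Proof. by move=> k [? ? ? ?] [? ? ? ?]; rewrite /qscale; congr Quat => /=; ring. Qed.

Lemma qscaleDl p : {morph qscale^~ p : k l / k + l}.
Proof. by case: p => ? ? ? ? k l; rewrite /qscale /=; congr Quat => /=; ring. Qed.

HB.instance Definition _ := GRing.Zmodule_isLmodule.Build R (quat R)
  qscaleA qscale1 qscaleDr qscaleDl.

Lemma qscaleAl k p q : k *: (p * q) = (k *: p) * q.
Proof. by case: p q => [? ? ? ?] [? ? ? ?]; congr Quat => /=; ring. Qed.

HB.instance Definition _ := GRing.Lmodule_isLalgebra.Build R (quat R) qscaleAl.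

Lemma qscaleAr k p q : k *: (p * q) = p * (k *: q).
Proof. by case: p q => [? ? ? ?] [? ? ? ?]; congr Quat => /=; ring. Qed.

HB.instance Definition _ := GRing.Lalgebra_isAlgebra.Build R (quat R) qscaleAr.

Lemma qsqnorm_ge0 p : 0 <= qsqnorm p.
Proof. by rewrite /qsqnorm !addr_ge0 ?sqr_ge0. Qed.

Lemma qsqnorm_eq0 p : (qsqnorm p == 0) = (p == 0).
Proof.
apply/idP/eqP => [|->]; last by rewrite /qsqnorm /= !expr0n /= !addr0.
rewrite /qsqnorm !paddr_eq0 ?addr_ge0 ?sqr_ge0 // !sqrf_eq0.
by case: p => a b c d /= /andP[/andP[/andP[/eqP-> /eqP->] /eqP->] /eqP->].
Qed.

Definition qunit : pred (quat R) := fun p => p != 0.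

Lemma qmulVr : {in qunit, left_inverse 1 qinv *%R}.
Proof.
move=> p; rewrite unfold_in /qunit -qsqnorm_eq0; case: p => a b c d p0.
by move: p0; rewrite /qsqnorm /= => p0; congr Quat; rewrite /= /qsqnorm /=; field.
Qed.

Lemma qmulrV : {in qunit, right_inverse 1 qinv *%R}.
Proof.
move=> p; rewrite unfold_in /qunit -qsqnorm_eq0; case: p => a b c d p0.
by move: p0; rewrite /qsqnorm /= => p0; congr Quat; rewrite /= /qsqnorm /=; field.
Qed.

Lemma qunitP p q : q * p = 1 /\ p * q = 1 -> qunit p.
Proof.
by move=> [qp _]; apply/eqP => p0; move: qp; rewrite p0 mulr0 => /esym/eqP; rewrite oner_eq0.
Qed.

Lemma qinv_out : {in [predC qunit], qinv =1 id}.
Proof.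
move=> p; rewrite inE /= unfold_in /qunit negbK => /eqP ->.
by congr Quat; rewrite /= ?oppr0 mulr0.
Qed.

HB.instance Definition _ := GRing.NzRing_hasMulInverse.Build (quat R)
  qmulVr qmulrV qunitP qinv_out.

Lemma qnormD p q : qnorm (p + q) <= qnorm p + qnorm q.
Proof.
rewrite -(@ler_pXn2r _ 2) ?nnegrE ?addr_ge0 ?sqrtr_ge0 //.
rewrite sqrrD !sqr_sqrtr ?qsqnorm_ge0 // /qnorm -sqrtrM ?qsqnorm_ge0 //.
set D := qr p * qr q + qi p * qi q + qj p * qj q + qk p * qk q.
suff DH : D <= Num.sqrt (qsqnorm p * qsqnorm q).
  suff -> : qsqnorm (p + q) = qsqnorm p + D *+ 2 + qsqnorm q.
    by rewrite lerD2r lerD2l lerMn2r DH orbT.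
  by rewrite /D /qsqnorm; case: p q {D DH} => [? ? ? ?] [? ? ? ?] /=; ring.
rewrite (le_trans (ler_norm D)) // -sqrtr_sqr ler_wsqrtr // -subr_ge0.
rewrite [X in 0 <= X](_ : _ =
  (qr p * qi q - qi p * qr q) ^+ 2 + (qr p * qj q - qj p * qr q) ^+ 2 +
  (qr p * qk q - qk p * qr q) ^+ 2 + (qi p * qj q - qj p * qi q) ^+ 2 +
  (qi p * qk q - qk p * qi q) ^+ 2 + (qj p * qk q - qk p * qj q) ^+ 2).
  by rewrite !addr_ge0 ?sqr_ge0.
by rewrite /D /qsqnorm; case: p q {D} => [? ? ? ?] [? ? ? ?] /=; ring.
Qed.

Lemma qnormZ k p : qnorm (k *: p) = `|k| * qnorm p.
Proof.
rewrite /qnorm (_ : qsqnorm _ = k ^+ 2 * qsqnorm p).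
  by rewrite sqrtrM ?sqr_ge0 // sqrtr_sqr.
by case: p => ? ? ? ?; rewrite /qsqnorm /=; ring.
Qed.

Lemma qnorm_eq0 p : qnorm p = 0 -> p = 0.
Proof.
move/eqP; rewrite sqrtr_eq0 => p0; apply/eqP.
by rewrite -qsqnorm_eq0 eq_le p0 qsqnorm_ge0.
Qed.

(* The norm, and hence the topology, of [quat R] is the Euclidean one. *)
HB.instance Definition _ := Lmodule_isNormed.Build R (quat R)
  qnormD qnormZ qnorm_eq0.

End QuatAlgebra.

Section SliceGeometry.
Variable R : realType.
Implicit Types (I J p q : quat R) (x y : R) (r : \bar R).

Definition qre p : R := qr p.
Definition qim p : quat R := p - (qre p)%:A.

Definition imag_units : set (quat R) := [set q | q ^+ 2 = - 1].

Definition slice_point I x y : quat R := x%:A + y *: I.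

Definition slice_line I : set (quat R) :=
  [set q | exists x y, q = slice_point I x y].

(* The sphere x + y S through p = x + I y; since S = - S, taking y = |Im p|
   is no restriction. *)
Definition sphere_of p : set (quat R) :=
  [set slice_point J (qre p) `|qim p| | J in imag_units].

Definition same_slice p q : Prop :=
  exists2 I, imag_units I & slice_line I p /\ slice_line I q.

Definition omega q p : R :=
  Num.sqrt ((qre q - qre p) ^+ 2 + (`|qim q| + `|qim p|) ^+ 2).

Definition sigma q p : R :=
  if `[< same_slice q p >] then `|q - p| else omega q p.

Definition tau q p : R :=
  if `[< same_slice q p >] then `|q - p|
  else Num.sqrt ((qre q - qre p) ^+ 2 + (`|qim q| - `|qim p|) ^+ 2).

Definition Sigma_ball p r : set (quat R) := [set q | ((sigma q p)%:E < r)%E].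
Definition Sigma_cball p r : set (quat R) := [set q | ((sigma q p)%:E <= r)%E].
Definition Omega_ball p r : set (quat R) := [set q | ((omega q p)%:E < r)%E].
Definition T_ball p r : set (quat R) := [set q | ((tau q p)%:E < r)%E].

Definition slice_cdisc J (c : quat R) r : set (quat R) :=
  [set z | slice_line J z /\ (`|z - c|%:E <= r)%E].

Definition T_cball p r : set (quat R) :=
  \bigcup_(J in imag_units) slice_cdisc J (slice_point J (qre p) `|qim p|) r.

Definition Sigma_annulus p r1 r2 : set (quat R) :=
  [set q | (r1 < (tau q p)%:E)%E /\ ((sigma q p)%:E < r2)%E].

Definition Omega_annulus p r1 r2 : set (quat R) :=
  Omega_ball p r2 `\` T_cball p r1.

End SliceGeometry.

(** The quaternions with the topology of the distance [sigma], which is finer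
    than the Euclidean one: [Sigma_ball] and [Sigma_annulus] are open for it,
    but in general not for the Euclidean topology.

    Compactness of subsets of [Sigma_annulus] is meant for this topology.  On
    Euclidean compact subsets the uniform convergence may fail: take p = I/2,
    a_n = (3/5 + (4/5) I)^n for n >= 0 and a_n = 0 for n < 0 (so r1 = 0, r2 = 1),
    z = 3/5 + (3/10) I, and a sequence q_k = x_k + y_k J_k converging to z with
    J_k != I and conj z_k - p = (1 - e_k)(3/5 - (4/5) I) for z_k = x_k + y_k I.
    If e_k -> 0 fast enough compared with |J_k - I|, the tails of the series at
    the q_k are unbounded, while {z, q_1, q_2, ...} is a Euclidean compact subset
    of the annulus. *)
Definition sigma_quat (R : realType) : Type := quat R.

Section SigmaTopology.
Variable R : realType.

HB.instance Definition _ := Choice.copy (sigma_quat R) (quat R).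

Definition sigma_open (U : set (sigma_quat R)) : Prop :=
  forall q, U q -> exists2 e : R, 0 < e & Sigma_ball q e%:E `<=` U.

Lemma sigma_openT : sigma_open setT.
Proof. by move=> q _; exists 1. Qed.

Lemma sigma_openI : setI_closed sigma_open.
Proof.
move=> U V oU oV q [/oU [e e0 eU] /oV [d d0 dV]].
exists (Num.min e d); first by rewrite lt_min e0.
by move=> z /=; rewrite /Sigma_ball /= lte_fin lt_min => /andP[ze zd]; split;
  [apply: eU | apply: dV]; rewrite /Sigma_ball /= lte_fin.
Qed.

Lemma sigma_open_bigU (I : Type) (f : I -> set (sigma_quat R)) :
  (forall i, sigma_open (f i)) -> sigma_open (\bigcup_i f i).
Proof.
move=> fo q [i _ /fo [e e0 ef]]; exists e => // z /ef ?; by exists i.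
Qed.

HB.instance Definition _ := isOpenTopological.Build (sigma_quat R)
  sigma_openT sigma_openI sigma_open_bigU.

End SigmaTopology.

Section SliceRegular.
Variable R : realType.

(* [f] is only constrained on [U]; its values outside [U] are irrelevant. *)
Definition slice_regular (U : set (quat R)) (f : quat R -> quat R) : Prop :=
  open U /\
  forall I, imag_units I ->
    let UI := [set z : R * R | U (slice_point I z.1 z.2)] in
    let fI := fun z : R * R => f (slice_point I z.1 z.2) in
    let dx := fun z => 'D_((1, 0) : R * R) fI z in
    let dy := fun z => 'D_((0, 1) : R * R) fI z in
    [/\ forall z, UI z -> derivable fI z (1, 0) /\ derivable fI z (0, 1),
        forall z, UI z -> {for z, continuous dx} /\ {for z, continuous dy} &
        forall z, UI z -> 2^-1 *: (dx z + I * dy z) = 0].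

End SliceRegular.

Section LaurentSeries.
Variable R : realType.
Implicit Types (p q : quat R) (a : int -> quat R).

(* Powers stand on the left of the coefficients, unlike in [horner]. *)
Definition left_eval (P : {poly quat R}) q : quat R :=
  \sum_(i < size P) q ^+ i * P`_i.

Definition star_pow_nat p (n : nat) q : quat R :=
  left_eval (('X - p%:P) ^+ n) q.

Definition star_neg_defined p q : Prop :=
  ~ sphere_of p q \/ (qim p <> 0 /\ q = qconj p).

Definition star_pow_neg p (m : nat) q : quat R :=
  if `[< ~ sphere_of p q >] then
    ((q - (qre p)%:A) ^+ 2 + (`|qim p| ^+ 2)%:A) ^- m
      * star_pow_nat (qconj p) m q
  else (qconj p - p) ^- m.

(* For n < 0 the value is meaningful only where [star_neg_defined p q]. *)
Definition star_pow p (n : int) q : quat R :=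
  match n with
  | Posz k => star_pow_nat p k q
  | Negz k => star_pow_neg p k.+1 q
  end.

Definition laurent_term a p q (n : int) : quat R := star_pow p n q * a n.

Definition laurent_pos a p q : (quat R)^nat :=
  fun n => laurent_term a p q (Posz n).

Definition laurent_neg a p q : (quat R)^nat :=
  fun n => laurent_term a p q (Negz n).

Definition laurent_undefined a p q : set nat :=
  [set m | ~ star_neg_defined p q /\ a (Negz m) <> 0].

(* A series having infinitely many nonzero terms undefined at q is regarded as
   not convergent at q; finitely many conventional values do not matter. The
   two halves of a bilateral series are required to converge separately. *)
Definition laurent_cvg a p q : Prop :=
  [/\ finite_set (laurent_undefined a p q),
      cvgn (series (laurent_pos a p q)) &
      cvgn (series (laurent_neg a p q))].

Definition laurent_abs_cvg a p q : Prop :=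
  [/\ finite_set (laurent_undefined a p q),
      cvgn [normed series (laurent_pos a p q)] &
      cvgn [normed series (laurent_neg a p q)]].

Definition laurent_sum a p q : quat R :=
  limn (series (laurent_pos a p q)) + limn (series (laurent_neg a p q)).

Definition laurent_unif_cvg a p (K : set (quat R)) : Prop :=
  {uniform K, (fun n q => series (laurent_pos a p q) n) @ \oo -->
              (fun q => limn (series (laurent_pos a p q)))} /\
  {uniform K, (fun n q => series (laurent_neg a p q) n) @ \oo -->
              (fun q => limn (series (laurent_neg a p q)))}.

Definition laurent_abs_unif_cvg a p (K : set (quat R)) : Prop :=
  (forall q, K q -> laurent_abs_cvg a p q) /\ laurent_unif_cvg a p K.

End LaurentSeries.

(* Main.v *)
(* Write p = x0 + I y0, q = x + J y, z = x + I y and let zbar be the conjugate of z.  Since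
   q (1 - J I) = (1 - J I) z and q (1 + J I) = (1 + J I) zbar, every power satisfies
     (q - p)^{*n} = (1 - J I)/2 (z - p)^n + (1 + J I)/2 (zbar - p)^n
   with both coefficients of norm at most 1, and |z - p|, |zbar - p| are, up to
   order, [omega q p] and the distance [sphere_dist q p] from p to the sphere of q.
   Hence |(q - p)^{*n}| is at most 2 sigma^n for n >= 0 and 2 tau^n for n < 0, and
   eventually at least a positive multiple of the same power, because both
   coefficients are nonzero when p and q lie on different slices.  Convergence and
   divergence then follow from the root test.

   For regularity, X^n - Y^n - n (X - Y) Y^(n-1) is O(|X - Y|^2) for commuting X, Y,
   with constants that stay summable against the coefficients.  Through the
   representation formula this becomes |f z' - f z - h * g z| <= C |h|^2 with h the
   point z' - z of the slice of J, so the derivative in the direction v is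
   (v_1 + v_2 J) * g and the Cauchy-Riemann equation holds; exchanging z and z' in
   the estimate shows that g is Lipschitz. *)
Require Import Defs.
From HB Require Import structures.
From mathcomp Require Import all_boot all_order all_algebra.
From mathcomp Require Import ring lra.
From mathcomp Require Import all_classical all_reals all_analysis.

Set Implicit Arguments.
Unset Strict Implicit.
Unset Printing Implicit Defensive.

Import Order.TTheory GRing.Theory Num.Theory.
Import numFieldNormedType.Exports.

Local Open Scope classical_set_scope.
Local Open Scope ring_scope.

(** * Norm and slices of the quaternions *)

Section QuaternionNorm.
Variable R : realType.
Implicit Types p q : quat R.

Lemma qnormM p q : `|p * q| = `|p| * `|q|.
Proof.
rewrite /Num.norm /= /qnorm -sqrtrM ?qsqnorm_ge0 //; congr Num.sqrt.
by case: p q => [? ? ? ?] [? ? ? ?]; rewrite /qsqnorm /=; ring.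
Qed.

Lemma qnorm1 : `|1 : quat R| = 1.
Proof. by rewrite /Num.norm /= /qnorm /qsqnorm /= !expr0n /= !addr0 expr1n sqrtr1. Qed.

Lemma qunitE q : (q \is a GRing.unit) = (q != 0).
Proof. by []. Qed.

Lemma qmulf_eq0 p q : (p * q == 0) = (p == 0) || (q == 0).
Proof. by rewrite -normr_eq0 qnormM mulf_eq0 !normr_eq0. Qed.

Lemma qnormX q n : `|q ^+ n| = `|q| ^+ n.
Proof. by elim: n => [|n IH]; rewrite ?expr0 ?qnorm1 // !exprS qnormM IH. Qed.

Lemma qnormV q : `|q^-1| = `|q|^-1.
Proof.
have [->|q0] := eqVneq q 0; first by rewrite invr_out ?qunitE ?eqxx // normr0 invr0.
have nq0 : `|q| != 0 by rewrite normr_eq0.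
by apply: (mulfI nq0); rewrite -qnormM divrr ?qunitE // qnorm1 divff.
Qed.

Lemma ler_norm_qr q : `|qr q| <= `|q|.
Proof.
rewrite {2}/Num.norm /= /qnorm -sqrtr_sqr ler_wsqrtr // /qsqnorm -!addrA lerDl.
by rewrite !addr_ge0 ?sqr_ge0.
Qed.

Lemma ler_norm_qi q : `|qi q| <= `|q|.
Proof.
rewrite {2}/Num.norm /= /qnorm -sqrtr_sqr ler_wsqrtr // /qsqnorm.
move: (sqr_ge0 (qr q)) (sqr_ge0 (qi q)) (sqr_ge0 (qj q)) (sqr_ge0 (qk q)); lra.
Qed.

Lemma ler_norm_qj q : `|qj q| <= `|q|.
Proof.
rewrite {2}/Num.norm /= /qnorm -sqrtr_sqr ler_wsqrtr // /qsqnorm.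
move: (sqr_ge0 (qr q)) (sqr_ge0 (qi q)) (sqr_ge0 (qj q)) (sqr_ge0 (qk q)); lra.
Qed.

Lemma ler_norm_qk q : `|qk q| <= `|q|.
Proof.
rewrite {2}/Num.norm /= /qnorm -sqrtr_sqr ler_wsqrtr // /qsqnorm.
move: (sqr_ge0 (qr q)) (sqr_ge0 (qi q)) (sqr_ge0 (qj q)) (sqr_ge0 (qk q)); lra.
Qed.

Lemma qnorm_le_sum q : `|q| <= `|qr q| + `|qi q| + `|qj q| + `|qk q|.
Proof.
have h (x y : R) : `|x| * `|y| >= 0 by rewrite mulr_ge0.
rewrite {1}/Num.norm /= /qnorm -[leRHS]ger0_norm ?addr_ge0 // -sqrtr_sqr.
rewrite ler_wsqrtr // /qsqnorm -(real_normK (num_real (qr q))).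
rewrite -(real_normK (num_real (qi q))) -(real_normK (num_real (qj q))).
rewrite -(real_normK (num_real (qk q))).
move: (h (qr q) (qi q)) (h (qr q) (qj q)) (h (qr q) (qk q)).
move: (h (qi q) (qj q)) (h (qi q) (qk q)) (h (qj q) (qk q)); nra.
Qed.

End QuaternionNorm.

Section Slices.
Variable R : realType.
Implicit Types (I J p q : quat R) (x y : R).

(** In the square of [a + v] the vector part is [2 a v] and the real part is [a^2 - |v|^2]; a
    nonzero [a] would kill [v] and force [a^2 = - 1]. *)
Lemma imag_unitsP I : imag_units I <-> qr I = 0 /\ qi I ^+ 2 + qj I ^+ 2 + qk I ^+ 2 = 1.
Proof.
rewrite /imag_units /= expr2; case: I => a b c d /=; split.
  move=> [] h1 h2 h3 h4.
  have a0 : a = 0.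
    have [//|a0] := eqVneq a 0.
    have b0 : b = 0 by apply: (mulfI a0); lra.
    have c0 : c = 0 by apply: (mulfI a0); lra.
    have d0 : d = 0 by apply: (mulfI a0); lra.
    by move: h1; rewrite b0 c0 d0; have := sqr_ge0 a; nra.
  by split=> //; move: h1; rewrite a0; lra.
by move=> [-> h]; congr Quat => /=; rewrite ?oppr0; try ring; lra.
Qed.

Lemma imag_unit_mul I : imag_units I -> I * I = - 1.
Proof. by rewrite /imag_units /= expr2. Qed.

Lemma imag_unitN I : imag_units I -> imag_units (- I).
Proof. by rewrite /imag_units /= sqrrN. Qed.

Lemma norm_imag_unit I : imag_units I -> `|I| = 1.
Proof.
move=> /imag_unitsP[h0 h]; rewrite /Num.norm /= /qnorm /qsqnorm h0 expr0n /= add0r.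
by rewrite h sqrtr1.
Qed.

Lemma imag_unit_exists : exists I : quat R, imag_units I.
Proof.
by exists (Quat 0 1 0 0); apply/imag_unitsP => /=; rewrite expr1n !expr0n /= !addr0.
Qed.

Lemma slice_pointD I x y x' y' :
  slice_point I x y + slice_point I x' y' = slice_point I (x + x') (y + y').
Proof. by rewrite /slice_point !scalerDl addrACA. Qed.

Lemma slice_pointN I x y : - slice_point I x y = slice_point I (- x) (- y).
Proof. by rewrite /slice_point !scaleNr opprD. Qed.

Lemma slice_pointB I x y x' y' :
  slice_point I x y - slice_point I x' y' = slice_point I (x - x') (y - y').
Proof. by rewrite slice_pointN slice_pointD. Qed.

Lemma slice_pointM I x y x' y' : imag_units I ->
  slice_point I x y * slice_point I x' y'
    = slice_point I (x * x' - y * y') (x * y' + y * x').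
Proof.
move=> /imag_unit_mul h; rewrite /slice_point mulrDl !mulrDr !mulr_algl.
rewrite -!scalerAl mulr_algr -!scalerAr h !scalerA scalerN.
by rewrite !scalerDl scaleNr [_ *: I - _]addrC addrACA.
Qed.

Lemma slice_point_comm I x y x' y' : imag_units I ->
  GRing.comm (slice_point I x y) (slice_point I x' y').
Proof.
by move=> hI; rewrite /GRing.comm !slice_pointM //; congr slice_point; ring.
Qed.

Lemma slice_pointZ I k x y : k *: slice_point I x y = slice_point I (k * x) (k * y).
Proof. by rewrite /slice_point scalerDr !scalerA. Qed.

Lemma slice_point_opp I x y : slice_point (- I) x y = slice_point I x (- y).
Proof. by rewrite /slice_point scalerN scaleNr. Qed.

Lemma slice_point0 I x : slice_point I x 0 = x%:A.
Proof. by rewrite /slice_point scale0r addr0. Qed.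

Lemma qre_slice I x y : imag_units I -> qre (slice_point I x y) = x.
Proof. by move=> /imag_unitsP[h _]; rewrite /qre /slice_point /= h mulr0 mulr1 addr0. Qed.

Lemma qim_slice I x y : imag_units I -> qim (slice_point I x y) = y *: I.
Proof. by move=> hI; rewrite /qim qre_slice // /slice_point addrC addKr. Qed.

Lemma norm_qim_slice I x y : imag_units I -> `|qim (slice_point I x y)| = `|y|.
Proof. by move=> hI; rewrite qim_slice // normrZ norm_imag_unit // mulr1. Qed.

Lemma norm_slice I x y : imag_units I ->
  `|slice_point I x y| = Num.sqrt (x ^+ 2 + y ^+ 2).
Proof.
move=> /imag_unitsP[h0 h]; rewrite /slice_point /Num.norm /= /qnorm; congr Num.sqrt.
rewrite /qsqnorm /= h0; transitivity (x ^+ 2 + y ^+ 2 * (qi I ^+ 2 + qj I ^+ 2 + qk I ^+ 2)).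
  by ring.
by rewrite h mulr1.
Qed.

Lemma slice_point_eq0 I x y : imag_units I ->
  (slice_point I x y == 0) = (x == 0) && (y == 0).
Proof.
move=> hI; rewrite -normr_eq0 norm_slice // sqrtr_eq0.
have := sqr_ge0 x; have := sqr_ge0 y => hx hy.
rewrite -!(sqrf_eq0 x) -!(sqrf_eq0 y); apply/idP/andP => [h|[/eqP-> /eqP->]].
  by split; apply/eqP; lra.
by rewrite addr0.
Qed.

Lemma slice_decomposition q :
  exists2 J, imag_units J & q = slice_point J (qre q) `|qim q|.
Proof.
have [h|h] := eqVneq (qim q) 0.
  have [I hI] := imag_unit_exists; exists I => //.
  by rewrite h normr0 slice_point0; apply/eqP; rewrite -subr_eq0; apply/eqP.
have nh : `|qim q| != 0 by rewrite normr_eq0.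
exists (`|qim q|^-1 *: qim q); last first.
  by rewrite /slice_point scalerA divff // scale1r /qim addrC subrK.
apply/imag_unitsP; split.
  by rewrite /= /qre mulr1 subrr mulr0.
rewrite [qi _]/= [qj _]/= [qk _]/= !exprMn -!mulrDr.
suff <- : `|qim q| ^+ 2 = (qi (qim q)) ^+ 2 + (qj (qim q)) ^+ 2 + (qk (qim q)) ^+ 2.
  by rewrite exprVn mulVf // expf_neq0.
rewrite {1}/Num.norm /= sqr_sqrtr ?qsqnorm_ge0 // /qsqnorm /= /qre mulr1 subrr.
by rewrite expr0n add0r.
Qed.

End Slices.

(** * Representation formula for regular powers *)

Section StarPowers.
Variable R : realType.
Implicit Types (I J p q c : quat R) (P : {poly quat R}) (x y : R).

Lemma left_eval_widen P q n : (size P <= n)%N ->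
  left_eval P q = \sum_(i < n) q ^+ i * P`_i.
Proof.
move=> hn; rewrite /left_eval (big_ord_widen n (fun i => q ^+ i * P`_i) hn).
rewrite big_mkcond; apply: eq_bigr => i _.
by case: ltnP => // hi; rewrite nth_default ?mulr0.
Qed.

Lemma left_evalB P Q q : left_eval (P - Q) q = left_eval P q - left_eval Q q.
Proof.
pose n := maxn (size (P - Q)) (maxn (size P) (size Q)).
rewrite !(@left_eval_widen _ q n) /n ?leq_max ?leqnn ?orbT //.
by rewrite -sumrB; apply: eq_bigr => i _; rewrite coefB mulrBr.
Qed.

Lemma left_evalMX P q : left_eval (P * 'X) q = q * left_eval P q.
Proof.
rewrite (@left_eval_widen _ q (size P).+1) ?size_polyMXn; last first.
  by have [->|P0] := eqVneq P 0; rewrite ?mul0r ?size_poly0 // size_mulX.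
rewrite big_ord_recl coefMX mulr0 add0r /left_eval mulr_sumr.
by apply: eq_bigr => i _; rewrite coefMX /= exprS mulrA.
Qed.

Lemma left_evalMC P c q : left_eval (P * c%:P) q = left_eval P q * c.
Proof.
pose n := maxn (size (P * c%:P)) (size P).
rewrite !(@left_eval_widen _ q n) /n ?leq_max ?leqnn ?orbT // mulr_suml.
by apply: eq_bigr => i _; rewrite coefMC mulrA.
Qed.

Lemma star_pow_nat0 p q : star_pow_nat p 0 q = 1.
Proof. by rewrite /star_pow_nat expr0 /left_eval size_poly1 big_ord1 coef1 mulr1. Qed.

(** The factor ['X - p%:P] is appended on the right: ['X] is central and becomes left multiplication
    by [q], while [p] multiplies the coefficients, hence the value, on the right. *)
Lemma star_pow_natS p n q :
  star_pow_nat p n.+1 q = q * star_pow_nat p n q - star_pow_nat p n q * p.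
Proof. by rewrite /star_pow_nat exprSr mulrBr left_evalB left_evalMX left_evalMC. Qed.

(* The representation formula expresses the value at x + J y of a slice function
   as [rep I J * f (x + I y) + rep (- I) J * f (x - I y)]. *)
Definition rep I J : quat R := 2^-1 *: (1 - J * I).

Lemma half_double q : 2^-1 *: (q + q) = q.
Proof. by rewrite scalerDr -scalerDl (_ : 2^-1 + 2^-1 = 1) ?scale1r //; lra. Qed.

Lemma rep_sum I J : rep I J + rep (- I) J = 1.
Proof.
rewrite /rep -scalerDr mulrN opprK addrACA addNr addr0.
exact: half_double.
Qed.

Lemma rep_same I : imag_units I -> rep I I = 1.
Proof.
move=> /imag_unit_mul h; rewrite /rep h opprK.
exact: half_double.
Qed.

Lemma repN_same I : imag_units I -> rep (- I) I = 0.
Proof. by move=> /imag_unit_mul h; rewrite /rep mulrN h opprK subrr scaler0. Qed.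

Lemma rep_neq0 I J : imag_units I -> J <> - I -> rep I J != 0.
Proof.
move=> /imag_unit_mul hI hJ; rewrite /rep scaler_eq0 invr_eq0 pnatr_eq0 /= subr_eq0.
apply/eqP => h; apply: hJ; have := congr1 (fun u => u * I) h.
by rewrite mul1r -mulrA hI mulrN1 => ->; rewrite opprK.
Qed.

Lemma norm_rep_le1 I J : imag_units I -> imag_units J -> `|rep I J| <= 1.
Proof.
move=> hI hJ; rewrite normrZ ger0_norm ?invr_ge0 // ler_pdivrMl // mulr1.
rewrite (le_trans (ler_normB _ _)) // qnormM (norm_imag_unit hI) (norm_imag_unit hJ) qnorm1; lra.
Qed.

(** Both [J * (1 - J * I)] and [(1 - J * I) * I] equal [I + J], so [rep I J] intertwines the slices
    of [J] and [I]. *)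
Lemma slice_point_rep I J x y : imag_units I -> imag_units J ->
  slice_point J x y * rep I J = rep I J * slice_point I x y.
Proof.
move=> hI hJ; rewrite /rep -scalerAr -scalerAl; congr (_ *: _).
rewrite /slice_point mulrDl [in RHS]mulrDr mulr_algl mulr_algr; congr (_ + _).
rewrite -scalerAl -scalerAr mulrBr mulr1 mulrBl mul1r [J * (J * I)]mulrA.
rewrite -[J * I * I]mulrA (imag_unit_mul hI) (imag_unit_mul hJ).
by rewrite mulN1r mulrN1 !opprK addrC.
Qed.

Lemma slice_point_repN I J x y : imag_units I -> imag_units J ->
  slice_point J x y * rep (- I) J = rep (- I) J * slice_point I x (- y).
Proof. by move=> hI hJ; rewrite slice_point_rep ?slice_point_opp //; apply: imag_unitN. Qed.

(** Induction with [star_pow_natS]: [q] moves across [u] and [v] as [z] and [w], and the right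
    factor [p] commutes with the powers of [z - p] and [w - p]. *)
Lemma star_pow_nat_intertwine p q u v z w n : u + v = 1 ->
  q * u = u * z -> q * v = v * w -> GRing.comm z p -> GRing.comm w p ->
  star_pow_nat p n q = u * (z - p) ^+ n + v * (w - p) ^+ n.
Proof.
move=> uv qu qv zp wp; elim: n => [|n IH]; first by rewrite star_pow_nat0 !expr0 !mulr1.
have aux t : GRing.comm t p -> (t - p) ^+ n * p = p * (t - p) ^+ n.
  by move=> tp; apply/esym/commrX/commrB => //; apply/esym.
rewrite star_pow_natS IH mulrDr mulrDl !mulrA qu qv opprD addrACA.
by rewrite -!mulrA !aux // -!mulrBr -!mulrBl -!exprS.
Qed.

Lemma star_pow_nat_slice I J x0 y0 x y n : imag_units I -> imag_units J ->
  star_pow_nat (slice_point I x0 y0) n (slice_point J x y) =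
    rep I J * slice_point I (x - x0) (y - y0) ^+ n +
    rep (- I) J * slice_point I (x - x0) (- y - y0) ^+ n.
Proof.
move=> hI hJ; rewrite -!slice_pointB; apply: star_pow_nat_intertwine.
- exact: rep_sum.
- exact: slice_point_rep.
- exact: slice_point_repN.
- exact: slice_point_comm.
- exact: slice_point_comm.
Qed.

Lemma sphere_of_slice I J x0 y0 x y : imag_units I -> imag_units J ->
  sphere_of (slice_point I x0 y0) (slice_point J x y) <-> x = x0 /\ `|y| = `|y0|.
Proof.
move=> hI hJ; rewrite /sphere_of (qre_slice _ _ hI) (norm_qim_slice _ _ hI).
split=> [[K hK h]|[-> h]].
  have := congr1 (@qre R) h; have := congr1 (fun q => `|qim q|) h.
  by rewrite !qre_slice // !norm_qim_slice // normr_id => -> ->.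
rewrite -h; have [y_ge0|y_lt0] := leP 0 y; first by exists J; rewrite ?ger0_norm.
by exists (- J); [exact: imag_unitN | rewrite slice_point_opp ltr0_norm ?opprK].
Qed.

Lemma qconj_slice I x y : imag_units I -> qconj (slice_point I x y) = slice_point I x (- y).
Proof.
by move=> /imag_unitsP[h _]; rewrite /qconj /slice_point; congr Quat => /=; rewrite ?h; ring.
Qed.

(** The polynomial [N] has real coefficients, so it passes across [rep I J]; on the slice of [I] it
    factors as [(z - p) * (z - conj p)]. *)
Lemma slice_norm_poly I J x0 y0 x y : imag_units I -> imag_units J ->
  let N := (slice_point J x y - x0%:A) ^+ 2 + (y0 ^+ 2)%:A in
  N * rep I J = rep I J * (slice_point I (x - x0) (y - y0) * slice_point I (x - x0) (y + y0)).
Proof.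
move=> hI hJ /=; rewrite -(slice_point0 J x0) slice_pointB subr0 expr2 slice_pointM //.
rewrite -(slice_point0 J (y0 ^+ 2)) slice_pointD slice_point_rep // slice_pointM //.
by congr (_ * slice_point _ _ _); ring.
Qed.

(** Off the sphere [N ^+ m] is invertible, so both sides may be multiplied by it. Across [rep I J]
    it becomes [(a * b) ^+ m], across [rep (- I) J] it becomes [(c * d) ^+ m], and [b], [d] are the
    bases in the expansion of the power of [q - conj p]. *)
Lemma star_pow_neg_slice I J x0 y0 x y m : imag_units I -> imag_units J ->
  ~ sphere_of (slice_point I x0 y0) (slice_point J x y) ->
  star_pow_neg (slice_point I x0 y0) m (slice_point J x y) =
    rep I J * slice_point I (x - x0) (y - y0) ^- m +
    rep (- I) J * slice_point I (x - x0) (- y - y0) ^- m.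
Proof.
move=> hI hJ nsph; rewrite /star_pow_neg; case: asboolP => // _.
rewrite qconj_slice // star_pow_nat_slice // qre_slice // norm_qim_slice //.
rewrite real_normK ?num_real //; set N := _ + _%:A.
have Np : N * rep I J = rep I J * _ := slice_norm_poly x0 y0 x y hI hJ.
(* The conjugate branch is the same identity for [- I] and [- y0], which describe the same point. *)
have Nn : N * rep (- I) J = rep (- I) J *
    (slice_point I (x - x0) (- y - y0) * slice_point I (x - x0) (- y + y0)).
  have := slice_norm_poly x0 (- y0) x y (imag_unitN hI) hJ.
  by rewrite /= sqrrN !slice_point_opp !opprD !opprK.
rewrite !opprK; set a := slice_point I _ (y - y0) in Np *.
set b := slice_point I _ (y + y0) in Np *.
set c := slice_point I _ (- y - y0) in Nn *.
set d := slice_point I _ (- y + y0) in Nn *.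
have ab : GRing.comm a b by exact: slice_point_comm.
have cd : GRing.comm c d by exact: slice_point_comm.
have a0 : a != 0.
  apply/negP; rewrite slice_point_eq0 // !subr_eq0 => /andP[/eqP h1 /eqP h2].
  by apply: nsph; apply/sphere_of_slice => //; rewrite h1 h2.
have c0 : c != 0.
  apply/negP; rewrite slice_point_eq0 // subr_eq0 subr_eq0 => /andP[/eqP h1 /eqP h2].
  by apply: nsph; apply/sphere_of_slice => //; rewrite h1 -h2 normrN.
have b0 : b != 0.
  apply/negP; rewrite slice_point_eq0 // subr_eq0 addr_eq0 => /andP[/eqP h1 /eqP h2].
  by apply: nsph; apply/sphere_of_slice => //; rewrite h1 h2 normrN.
have powN A z : N * A = A * z -> N ^+ m * A = A * z ^+ m.
  move=> h; elim: m => [|k IH]; first by rewrite !expr0 mul1r mulr1.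
  by rewrite exprS -mulrA IH mulrA h -mulrA -exprS.
have d0 : d != 0.
  apply/negP; rewrite slice_point_eq0 // subr_eq0 addr_eq0 => /andP[/eqP h1 /eqP h2].
  by apply: nsph; apply/sphere_of_slice => //; rewrite h1 -normrN h2 normrN.
(* If [N] vanished, the intertwining relations would make both coefficients zero, against
   [rep_sum]. *)
have N0 : N != 0.
  apply/eqP => N0; have := rep_sum I J.
  move: Np Nn; rewrite N0 !mul0r => /esym/eqP.
  rewrite !qmulf_eq0 (negbTE a0) (negbTE b0) !orbF => /eqP ->.
  move=> /esym/eqP; rewrite !qmulf_eq0 (negbTE c0) (negbTE d0) !orbF => /eqP ->.
  by move=> /eqP; rewrite addr0 eq_sym oner_eq0.
have Nu : N ^+ m \is a GRing.unit by rewrite unitrX.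
apply: (can_inj (mulKr Nu)); rewrite mulVKr // mulrDr !mulrA.
rewrite (powN _ _ Np) (powN _ _ Nn) ab cd !exprMn_comm; [|exact: esym..].
by rewrite -!mulrA !mulrV ?mulr1 ?unitrX.
Qed.

End StarPowers.

(** * Series of quaternions and the root test *)

Section QuaternionSeries.
Variable R : realType.
Implicit Types (u : nat -> quat R) (M : nat -> R).

Lemma quat_series_comp (f : quat R -> R) u n : {morph f : p q / p + q} -> f 0 = 0 ->
  f (series u n) = series (f \o u) n.
Proof. by move=> fD f0; rewrite /series /= (big_morph f fD f0). Qed.

(** Absolute convergence descends to the four real coordinates, and their sums are the coordinates
    of the limit. *)
Lemma quat_series_cvg u : cvgn [normed series u] -> cvgn (series u).
Proof.
move=> cu.
have compo (f : quat R -> R) : (forall q, `|f q| <= `|q|) -> cvgn (series (f \o u)).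
  move=> fle; apply: normed_cvg; apply: (series_le_cvg _ _ _ cu) => n //=.
have /cvg_ex[lr hr] := compo _ (@ler_norm_qr R).
have /cvg_ex[li hi] := compo _ (@ler_norm_qi R).
have /cvg_ex[lj hj] := compo _ (@ler_norm_qj R).
have /cvg_ex[lk hk] := compo _ (@ler_norm_qk R).
apply/cvg_ex; exists (Quat lr li lj lk); apply/cvgrPdist_lt => e e0.
have e4 : 0 < e / 4 by rewrite divr_gt0.
move/cvgrPdist_lt: hr => /(_ _ e4) hr; move/cvgrPdist_lt: hi => /(_ _ e4) hi.
move/cvgrPdist_lt: hj => /(_ _ e4) hj; move/cvgrPdist_lt: hk => /(_ _ e4) hk.
near=> n.
rewrite (le_lt_trans (qnorm_le_sum _)) //=.
rewrite !(@quat_series_comp _ u n) //.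
have h1 : `|lr - series (@qr R \o u) n| < e / 4 by near: n.
have h2 : `|li - series (@qi R \o u) n| < e / 4 by near: n.
have h3 : `|lj - series (@qj R \o u) n| < e / 4 by near: n.
have h4 : `|lk - series (@qk R \o u) n| < e / 4 by near: n.
by move: h1 h2 h3 h4; lra.
Unshelve. all: by end_near. Qed.

Lemma series_sub_le u M n m : (forall k, `|u k| <= M k) -> (n <= m)%N ->
  `|series u m - series u n| <= series M m - series M n.
Proof.
move=> uM nm; rewrite !sub_series nm (le_trans (ler_norm_sum _ _ _)) //.
exact: ler_sum.
Qed.

Lemma norm_lim_le (v : nat -> quat R) (l : quat R) (C : R) (b : quat R) :
  v @ \oo --> l -> (\forall n \near \oo, `|v n - b| <= C) -> `|l - b| <= C.
Proof.
move=> vl vC; have : (fun n => `|v n - b|) @ \oo --> `|l - b|.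
  by apply: cvg_norm; apply: cvgB => //; exact: cvg_cst.
by move=> /cvgr_to_le; apply.
Qed.

Section Majorized.
Variables (u : nat -> quat R) (M : nat -> R).
Hypothesis uM : forall n, `|u n| <= M n.
Hypothesis cM : cvgn (series M).

Lemma majorized_series_normed_cvg : cvgn [normed series u].
Proof. by apply: (series_le_cvg _ _ _ cM) => //= n; exact: le_trans (uM n). Qed.

Lemma majorized_series_cvg : cvgn (series u).
Proof. exact/quat_series_cvg/majorized_series_normed_cvg. Qed.

(** The bound on [series u m - series u n] can be made independent of [m], since the partial sums of
    the majorant lie below their limit; it then survives the limit in [m]. *)
Lemma majorized_series_tail n : `|limn (series u) - series u n| <= limn (series M) - series M n.
Proof.
apply: (norm_lim_le majorized_series_cvg); near=> m.
apply: le_trans (series_sub_le uM _) _; first by near: m; exact: nbhs_infty_ge.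
rewrite lerD2r; apply: nondecreasing_cvgn_le => //.
by apply: nondecreasing_series => k _ _; exact: le_trans (uM k).
Unshelve. all: by end_near. Qed.

End Majorized.

Lemma weierstrass_M_test (T : choiceType) (K : set T) (t : nat -> T -> quat R) M :
  (forall n x, K x -> `|t n x| <= M n) -> cvgn (series M) ->
  {uniform K, (fun n x => series (t ^~ x) n) @ \oo --> (fun x => limn (series (t ^~ x)))}.
Proof.
move=> tM cM P /uniform_nbhs[E [entE EP]]; apply: (filterS EP).
move: entE; rewrite -entourage_ballE => -[e /= e0 eE].
have /cvgrPdist_lt/(_ _ e0) := cM; apply: filterS => n hn x Kx.
apply: eE; rewrite /= -ball_normE /=.
apply: le_lt_trans (majorized_series_tail (fun k => tM k x Kx) cM n) _.
exact: le_lt_trans (ler_norm _) hn.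
Qed.

End QuaternionSeries.

(** * The root test *)

Section RootTest.
Variable R : realType.
Implicit Types (b : nat -> quat R) (r s : R) (L : \bar R).

Local Notation root_limsup b := (limn_esup (fun n : nat => (`|b n| `^ n%:R^-1)%:E)).

Lemma powR_root_lt x r (n : nat) : 0 <= x -> 0 < r -> x `^ n.+1%:R^-1 < r -> x < r ^+ n.+1.
Proof.
move=> x0 r0 h; have -> : x = (x `^ n.+1%:R^-1) ^+ n.+1.
  by rewrite -powR_mulrn ?powR_ge0 // -powRrM mulVf ?pnatr_eq0 // powRr1.
by rewrite ltrXn2r ?powR_ge0.
Qed.

Lemma powR_root_gt x r (n : nat) : 0 <= x -> 0 <= r -> r < x `^ n.+1%:R^-1 -> r ^+ n.+1 < x.
Proof.
move=> x0 r0 h; have -> : x = (x `^ n.+1%:R^-1) ^+ n.+1.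
  by rewrite -powR_mulrn ?powR_ge0 // -powRrM mulVf ?pnatr_eq0 // powRr1.
by rewrite ltrXn2r ?powR_ge0.
Qed.

Lemma root_limsup_lt b s : 0 < s -> (root_limsup b < s%:E)%E ->
  exists C, forall n, `|b n| <= C * s ^+ n.
Proof.
move=> s0; rewrite /limn_esup limf_esupE => /ereal_inf_lt[_ [V [N _ NV] <-] hV].
have sn n : 0 < s ^+ n by rewrite exprn_gt0.
(* The summand 1 covers the tail, where the [n]-th roots lie below [s]; the finite sum covers the
   indices up to [N]. *)
exists (1 + \sum_(k < N.+1) `|b k| / s ^+ k) => n; rewrite -ler_pdivrMr //.
(* Splitting at [N.+1] keeps index 0 out of the tail: there the exponent is [0^-1 = 0], and the root
   carries no information. *)
have [nN|Nn] := ltnP n N.+1.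
  rewrite (bigD1 (Ordinal nN)) //= addrCA lerDl addr_ge0 // sumr_ge0 // => k _.
  by rewrite divr_ge0 // ltW.
rewrite (@le_trans _ _ 1) //; last first.
  by rewrite lerDl sumr_ge0 // => k _; rewrite divr_ge0 // ltW.
have Vn : V n by apply: NV; exact: ltnW.
case: n Nn Vn => // n _ Vn; rewrite ler_pdivrMr // mul1r; apply/ltW/powR_root_lt => //.
rewrite -lte_fin; apply: le_lt_trans hV; apply: ereal_sup_ubound.
by exists n.+1.
Qed.

Lemma root_limsup_gt b s N : 0 <= s -> (s%:E < root_limsup b)%E ->
  exists2 n, (N <= n)%N & s ^+ n < `|b n|.
Proof.
move=> s0; rewrite /limn_esup limf_esupE => hs.
have : (s%:E < ereal_sup ((fun n : nat => (`|b n| `^ n%:R^-1)%:E) @` [set n | (N.+1 <= n)%N]))%E.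
  apply: lt_le_trans hs _; apply: ereal_inf_lbound; exists [set n | (N.+1 <= n)%N] => //.
  by exists N.+1.
move=> /ereal_sup_gt[_ [[//|n] /= Nn <-]]; rewrite lte_fin => h.
by exists n.+1; [exact: ltnW|exact: powR_root_gt].
Qed.

(** Comparison with a geometric series of ratio [r / s]. *)
Lemma geometric_bound_cvg b C r s : 0 <= r -> r < s ->
  (forall n, `|b n| * s ^+ n <= C) -> cvgn (series (fun n => `|b n| * r ^+ n)).
Proof.
move=> r0 rs hC.
have s0 : 0 < s by exact: le_lt_trans rs.
have cg : cvgn (series (geometric C (r / s))).
  by apply: is_cvg_geometric_series; rewrite ger0_norm ?divr_ge0 ?(ltW s0) // ltr_pdivrMr ?mul1r.
apply: (series_le_cvg _ _ _ cg) => n.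
- by rewrite mulr_ge0 ?exprn_ge0.
- by rewrite /geometric mulr_ge0 ?exprn_ge0 ?divr_ge0 ?(ltW s0) // (le_trans _ (hC 0%N)) // expr0 mulr1.
rewrite /geometric /= expr_div_n mulrA (ler_pdivlMr _ _ (exprn_gt0 n s0)) mulrAC.
by rewrite ler_wpM2r ?exprn_ge0.
Qed.

Lemma ereal_between (x : R) L : (x%:E < L)%E -> exists2 s, x < s & (s%:E < L)%E.
Proof.
case: L => [l||] //; rewrite ?lte_fin => h.
  by exists ((x + l) / 2); rewrite ?lte_fin ?midf_lt.
by exists (x + 1); rewrite ?ltrDl ?ltry.
Qed.

Lemma ereal_between_r (x : R) L : (0 <= L)%E -> (L < x%:E)%E ->
  exists s, [/\ 0 < s, s < x & (L < s%:E)%E].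
Proof.
case: L => [l||] //; rewrite ?lte_fin lee_fin => l0 h.
by exists ((l + x) / 2); rewrite lte_fin !midf_lt //; split=> //; apply: le_lt_trans (midf_lt h).1.
Qed.

(** With [s] between [t] and the upper limit, [(t / s) ^+ n] tends to 0, so [s ^+ n] eventually
    exceeds [C * t ^+ n], and [|b n|] exceeds [s ^+ n] for arbitrarily large [n]. *)
Lemma root_limsup_unbounded b t : 0 < t -> (t%:E < root_limsup b)%E ->
  forall C N, exists2 n, (N <= n)%N & C * t ^+ n < `|b n|.
Proof.
move=> t0 /ereal_between[s ts sL] C N.
have s0 : 0 < s by exact: lt_trans ts.
have q1 : `|t / s| < 1 by rewrite ger0_norm ?divr_ge0 ?ltW // ltr_pdivrMr ?mul1r.
have C0 : 0 < (`|C| + 1)^-1 by rewrite invr_gt0 ltr_wpDl.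
have /cvgrPdist_lt/(_ _ C0) [N' _ hN'] := cvg_expr q1.
have [n nN sn] := @root_limsup_gt b s (maxn N N') (ltW s0) sL.
exists n; first exact: leq_trans (leq_maxl _ _) nN.
apply: le_lt_trans sn; have := hN' n (leq_trans (leq_maxr _ _) nN).
rewrite /= sub0r normrN ger0_norm ?exprn_ge0 ?divr_ge0 ?(ltW t0) ?(ltW s0) //.
rewrite expr_div_n ltr_pdivrMr ?exprn_gt0 // ltr_pdivlMl ?ltr_wpDl // => /ltW.
apply: le_trans; rewrite ler_wpM2r ?exprn_ge0 ?(ltW t0) //.
by rewrite (le_trans (ler_norm _)) // lerDl.
Qed.

End RootTest.

(** * Regular powers against sigma and tau *)

Section SliceDistances.
Variable R : realType.
Implicit Types (I J p q : quat R) (x y : R).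

(* The distance from p to the sphere of q; unlike [tau] it is continuous. *)
Definition sphere_dist q p : R :=
  Num.sqrt ((qre q - qre p) ^+ 2 + (`|qim q| - `|qim p|) ^+ 2).

Lemma same_slice_refl_slice I x y x0 y0 : imag_units I ->
  same_slice (slice_point I x y) (slice_point I x0 y0).
Proof. by move=> hI; exists I => //; split; [exists x, y|exists x0, y0]. Qed.

Lemma not_same_slice I J x y x0 y0 : imag_units I -> imag_units J ->
  ~ same_slice (slice_point J x y) (slice_point I x0 y0) ->
  [/\ J <> I, J <> - I, y != 0 & y0 != 0].
Proof.
move=> hI hJ ns; split.
- by move=> JI; apply: ns; rewrite JI; exact: same_slice_refl_slice.
- by move=> JI; apply: ns; rewrite JI slice_point_opp; exact: same_slice_refl_slice.
- apply/eqP => y00; apply: ns; rewrite y00 slice_point0 -(slice_point0 I).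
  exact: same_slice_refl_slice.
- apply/eqP => y00; apply: ns; rewrite y00 (slice_point0 I) -(slice_point0 J).
  exact: same_slice_refl_slice.
Qed.

Lemma sphere_ofE p q : sphere_of p q <-> qre q = qre p /\ `|qim q| = `|qim p|.
Proof.
have [I hI ->] := slice_decomposition p; have [J hJ ->] := slice_decomposition q.
by rewrite sphere_of_slice // !qre_slice // !norm_qim_slice // !normr_id.
Qed.

Lemma sphere_dist_gt0 q p : (0 < sphere_dist q p) <-> ~ sphere_of p q.
Proof.
rewrite /sphere_dist sqrtr_gt0 sphere_ofE; split.
  by move=> h [e1 e2]; move: h; rewrite e1 e2 !subrr expr0n addr0 ltxx.
move=> h; rewrite lt_neqAle addr_ge0 ?sqr_ge0 // andbT eq_sym paddr_eq0 ?sqr_ge0 //.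
by rewrite !sqrf_eq0 !subr_eq0; apply/negP => /andP[/eqP h1 /eqP h2]; apply: h.
Qed.

(** On a common slice [|q - p|] is the distance from [p] to one of the points where the slice meets
    the sphere of [q]; the nearest gives [sphere_dist], the farthest [omega]. *)
Lemma same_slice_between q p : sphere_dist q p <= `|q - p| <= omega q p \/ ~ same_slice q p.
Proof.
have [[I hI [[x [y ->]] [x0 [y0 ->]]]]|] := pselect (same_slice q p); last by right.
left; rewrite slice_pointB norm_slice // /sphere_dist /omega !qre_slice // !norm_qim_slice //.
have h : y * y0 <= `|y| * `|y0| by rewrite -normrM ler_norm.
have h' : - (y * y0) <= `|y| * `|y0| by rewrite -normrM ler_normr lexx orbT.
have n1 := real_normK (num_real y); have n2 := real_normK (num_real y0).
by apply/andP; split; rewrite ler_wsqrtr // lerD2l; lra.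
Qed.

Lemma sphere_dist_le_omega q p : sphere_dist q p <= omega q p.
Proof.
rewrite ler_wsqrtr // lerD2l.
by have := mulr_ge0 (normr_ge0 (qim q)) (normr_ge0 (qim p)); lra.
Qed.

Lemma sphere_dist_lt_omega q p : ~ same_slice q p -> sphere_dist q p < omega q p.
Proof.
have [I hI ep] := slice_decomposition p; have [J hJ eq] := slice_decomposition q.
rewrite {1}ep {1}eq => /not_same_slice[] // _ _ y0 y1.
have h : 0 < `|qim q| * `|qim p| by rewrite mulr_gt0 // lt_def ?y0 ?y1 normr_ge0.
have h1 := sqr_ge0 (qre q - qre p); have h2 := sqr_ge0 (`|qim q| - `|qim p|).
by rewrite ltr_sqrt; lra.
Qed.

Lemma sphere_dist_le_tau q p : sphere_dist q p <= tau q p.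
Proof.
rewrite /tau; case: asboolP => // ss.
by case: (same_slice_between q p) => // /andP[].
Qed.

Lemma sigma_le_omega q p : sigma q p <= omega q p.
Proof.
rewrite /sigma; case: asboolP => // ss.
by case: (same_slice_between q p) => // /andP[].
Qed.

Lemma sigma_ge0 q p : 0 <= sigma q p.
Proof. by rewrite /sigma; case: ifP => _; rewrite ?sqrtr_ge0. Qed.

Lemma tau_ge0 q p : 0 <= tau q p.
Proof. by rewrite /tau; case: ifP => _; rewrite ?sqrtr_ge0. Qed.

(** A slice through [p] meets the sphere of [p] only in [p] and its conjugate. *)
Lemma same_slice_sphere q p : same_slice q p -> sphere_of p q -> q <> p ->
  q = qconj p /\ qim p <> 0.
Proof.
move=> [I hI [[x [y ->]] [x0 [y0 ->]]]] /sphere_of_slice[] // -> yy0 neq.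
have yN : y = - y0.
  have := eqVneq y y0; case=> [e|ne]; first by rewrite e in neq.
  move: yy0 => /eqP; rewrite eqr_norm2 (negbTE ne) /= => /eqP //.
rewrite qconj_slice // yN; split => // /eqP.
rewrite qim_slice // scaler_eq0 => /orP[/eqP y00|/eqP I0].
  by apply: neq; rewrite yN y00 oppr0.
by move: (norm_imag_unit hI) => /eqP; rewrite I0 normr0 eq_sym oner_eq0.
Qed.

(** Together with [tau_gt0_star_neg_defined], this shows that [tau] vanishes exactly where the
    negative powers have no value. *)
Lemma star_neg_defined_tau q p : 0 < tau q p -> star_neg_defined p q.
Proof.
rewrite /tau /star_neg_defined; case: asboolP => [ss|_ /sphere_dist_gt0]; last by left.
rewrite normr_gt0 subr_eq0 => /eqP neq.
have [h|] := pselect (sphere_of p q); last by left.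
by have [-> ?] := same_slice_sphere ss h neq; right.
Qed.

Lemma star_pow_nat_same q p n : same_slice q p -> star_pow_nat p n q = (q - p) ^+ n.
Proof.
move=> [I hI [[x [y ->]] [x0 [y0 ->]]]].
by rewrite star_pow_nat_slice // rep_same // repN_same // mul0r addr0 mul1r slice_pointB.
Qed.

Lemma star_pow_neg_same q p n : same_slice q p -> star_neg_defined p q ->
  star_pow_neg p n q = (q - p) ^- n.
Proof.
move=> [I hI [[x [y ->]] [x0 [y0 ->]]]].
have [h|ns _] := pselect (sphere_of (slice_point I x0 y0) (slice_point I x y)).
  by move=> [//|[_ e]]; rewrite /star_pow_neg; case: asboolP => // _; rewrite e.
by rewrite star_pow_neg_slice // rep_same // repN_same // mul0r addr0 mul1r slice_pointB.
Qed.

(** Taking both imaginary parts nonnegative makes [u] the shorter base and [v] the longer one. Hence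
    [v] governs the positive powers and [u] the negative ones, and on different slices the
    coefficient of the governing term is nonzero. *)
Lemma star_pow_representation q p : exists A B u v : quat R,
  [/\ `|A| <= 1, `|B| <= 1, `|u| = sphere_dist q p & `|v| = omega q p] /\
  [/\ ~ same_slice q p -> A != 0 /\ B != 0,
      forall n, star_pow_nat p n q = A * u ^+ n + B * v ^+ n &
      ~ sphere_of p q -> forall n, star_pow_neg p n q = A * u ^- n + B * v ^- n].
Proof.
have [I hI ep] := slice_decomposition p; have [J hJ eq] := slice_decomposition q.
pose y0 := `|qim p|; pose y := `|qim q|.
exists (rep I J), (rep (- I) J), (slice_point I (qre q - qre p) (y - y0)),
  (slice_point I (qre q - qre p) (- y - y0)); split; split.
- exact: norm_rep_le1.
- exact/norm_rep_le1/hJ/imag_unitN.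
- by rewrite norm_slice.
- by rewrite norm_slice // -opprD sqrrN.
- rewrite {1}ep {1}eq => /not_same_slice[] // h1 h2 _ _.
  by split; apply: rep_neq0; rewrite ?opprK //; exact: imag_unitN.
- by move=> n; rewrite {1}ep {1}eq star_pow_nat_slice.
- by rewrite {1 2}ep {1 2}eq => h n; rewrite star_pow_neg_slice.
Qed.

(** The factor 2 counts the two coefficients of norm at most 1; on a common slice a single power
    remains. *)
Lemma star_pow_nat_le q p n : `|star_pow_nat p n q| <= 2 * sigma q p ^+ n.
Proof.
have [ss|ns] := pselect (same_slice q p).
  rewrite /sigma asboolT // star_pow_nat_same // qnormX.
  by rewrite ler_peMl ?exprn_ge0 // ler1n.
rewrite /sigma asboolF //; have [A [B [u [v [[A1 B1 eu ev] [_ -> _]]]]]] := star_pow_representation q p.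
rewrite (le_trans (ler_normD _ _)) // !qnormM !qnormX eu ev mulrDl !mul1r.
apply: lerD; last by rewrite ler_piMl ?exprn_ge0 ?sqrtr_ge0.
apply: le_trans (_ : sphere_dist q p ^+ n <= _).
  by rewrite ler_piMl ?exprn_ge0 ?sqrtr_ge0.
by rewrite lerXn2r ?nnegrE ?sqrtr_ge0 ?sphere_dist_le_omega.
Qed.

Lemma star_pow_neg_le q p n : 0 < tau q p -> `|star_pow_neg p n q| <= 2 * tau q p ^- n.
Proof.
move=> tau0; have [ss|ns] := pselect (same_slice q p).
  move: tau0 (star_neg_defined_tau tau0); rewrite /tau asboolT // => tau0 dq.
  by rewrite star_pow_neg_same // qnormV qnormX ler_peMl ?invr_ge0 ?exprn_ge0 // ler1n.
move: tau0; rewrite /tau asboolF // -/(sphere_dist q p) => sd0.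
have [A [B [u [v [[A1 B1 eu ev] [_ _ ->]]]]]] := star_pow_representation q p; last exact/sphere_dist_gt0.
rewrite (le_trans (ler_normD _ _)) // !qnormM !qnormV !qnormX eu ev mulrDl !mul1r.
have om0 : 0 < omega q p by exact: lt_le_trans sd0 (sphere_dist_le_omega q p).
apply: lerD; first by rewrite ler_piMl ?invr_ge0 ?exprn_ge0 ?sqrtr_ge0.
apply: le_trans (_ : omega q p ^- n <= _).
  by rewrite ler_piMl ?invr_ge0 ?exprn_ge0 ?sqrtr_ge0.
by rewrite lef_pV2 ?posrE ?exprn_gt0 // lerXn2r ?nnegrE ?sqrtr_ge0 ?sphere_dist_le_omega.
Qed.

Lemma two_term_lower_bound (A B u v : quat R) : B != 0 -> `|u| < `|v| ->
  exists2 c, 0 < c & \forall n \near \oo, c * `|v| ^+ n <= `|A * u ^+ n + B * v ^+ n|.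
Proof.
move=> B0 uv; have v0 : 0 < `|v| by exact: le_lt_trans uv.
have c0 : 0 < `|B| / 2 by rewrite divr_gt0 ?normr_gt0.
exists (`|B| / 2) => //.
have q1 : `|(`|u| / `|v|)| < 1 by rewrite ger0_norm ?divr_ge0 // ltr_pdivrMr ?mul1r.
(* Eventually [|A| * |u| ^+ n] is below half of [|B| * |v| ^+ n]; the [+ 1] guards against
   [A = 0]. *)
have d0 : 0 < `|B| / 2 / (`|A| + 1) by rewrite divr_gt0 // ltr_wpDl.
have /cvgrPdist_lt/(_ _ d0) := cvg_expr q1; apply: filterS => n.
rewrite sub0r normrN normrX ger0_norm ?divr_ge0 // expr_div_n ltr_pdivrMr ?exprn_gt0 //.
rewrite mulrAC ltr_pdivlMr ?ltr_wpDl // => h.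
have un : 0 <= `|u| ^+ n by rewrite exprn_ge0.
have := lerB_normD (B * v ^+ n) (A * u ^+ n); rewrite [B * _ + _]addrC !qnormM !qnormX.
by move: h; lra.
Qed.

Lemma star_pow_nat_ge q p : 0 < sigma q p -> exists2 c, 0 < c &
  \forall n \near \oo, c * sigma q p ^+ n <= `|star_pow_nat p n q|.
Proof.
have [ss|ns] := pselect (same_slice q p).
  rewrite /sigma asboolT // => s0; exists 1 => //; near=> n.
  by rewrite star_pow_nat_same // qnormX mul1r.
rewrite /sigma asboolF // => s0.
have [A [B [u [v [[_ _ eu ev] [/(_ ns)[A0 B0] e _]]]]]] := star_pow_representation q p.
have := @two_term_lower_bound A B u v B0; rewrite eu ev => /(_ (sphere_dist_lt_omega ns)).
by move=> [c c0 hc]; exists c => //; apply: filterS hc => n; rewrite e.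
Unshelve. all: by end_near. Qed.

Lemma star_pow_neg_ge q p : 0 < tau q p -> exists2 c, 0 < c &
  \forall n \near \oo, c * (tau q p)^-1 ^+ n <= `|star_pow_neg p n q|.
Proof.
move=> t0; have dq := star_neg_defined_tau t0; have [ss|ns] := pselect (same_slice q p).
  exists 1 => //; near=> n.
  by rewrite star_pow_neg_same // /tau asboolT // qnormV qnormX exprVn mul1r.
move: t0; rewrite /tau asboolF // -/(sphere_dist q p) => s0.
have [A [B [u [v [[_ _ eu ev] [/(_ ns)[A0 B0] _ e]]]]]] := star_pow_representation q p.
(* For negative powers the roles are exchanged: [u^-1] is the longer base. *)
have := @two_term_lower_bound B A v^-1 u^-1 A0; rewrite !qnormV eu ev.
rewrite ltf_pV2 ?posrE //; last exact: lt_trans (sphere_dist_lt_omega ns).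
move=> /(_ (sphere_dist_lt_omega ns)) [c c0 hc]; exists c => //; apply: filterS hc => n.
by rewrite !exprVn addrC e //; exact/sphere_dist_gt0.
Unshelve. all: by end_near. Qed.

End SliceDistances.

(** * Convergence and divergence of the Laurent series *)

Section LaurentConvergence.
Variables (R : realType) (a : int -> quat R) (R1 R2 : \bar R).
Hypothesis R1_ge0 : (0 <= R1)%E.
Hypothesis R2_ge0 : (0 <= R2)%E.
Hypothesis R1E : R1 = limn_esup (fun m : nat => (`|a (- m%:Z)| `^ m%:R^-1)%:E).
Hypothesis R2E : (R2^-1)%E = limn_esup (fun n : nat => (`|a n%:Z| `^ n%:R^-1)%:E).

Lemma pos_coef_cvg r : 0 <= r -> (r%:E < R2)%E ->
  cvgn (series (fun n => `|a (Posz n)| * r ^+ n)).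
Proof.
move=> r0 /ereal_between[s rs sR2]; have s0 : 0 < s by exact: le_lt_trans rs.
have : (limn_esup (fun n : nat => (`|a n%:Z| `^ n%:R^-1)%:E) < (s^-1)%:E)%E.
  by rewrite -R2E inve_plt ?inE ?lee_fin ?invr_ge0 ?(ltW s0) // inver gt_eqF ?invr_gt0 // invrK.
move=> h; have [|C hC] := @root_limsup_lt _ (a \o Posz) s^-1 _ h; first by rewrite invr_gt0.
 apply: (@geometric_bound_cvg _ (a \o Posz) C r s) => // n.
by have := hC n; rewrite exprVn ler_pdivlMr ?exprn_gt0.
Qed.

Lemma neg_coef_cvg r : (R1 < r%:E)%E ->
  cvgn (series (fun n => `|a (Negz n)| * r^-1 ^+ n)).
Proof.
move=> /(ereal_between_r R1_ge0)[s [s0 sr R1s]].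
have [|C hC] := @root_limsup_lt _ (fun n => a (- n%:Z)) s s0; first by rewrite -R1E.
have r0 : 0 < r by exact: lt_trans sr.
(* [Negz n] is [- (n + 1)], so the bound [C * s ^+ n.+1] gives the constant [C * s]. *)
apply: (@geometric_bound_cvg _ (a \o Negz) (C * s) r^-1 s^-1) => [||n].
- by rewrite invr_ge0 ltW.
- by rewrite ltf_pV2 ?posrE.
by have := hC n.+1; rewrite -NegzE exprS mulrA exprVn ler_pdivrMr ?exprn_gt0.
Qed.

Variable p : quat R.

Lemma laurent_abs_unif_cvg_bounded (K : set (quat R)) r1 r2 :
  (R1 < r1%:E)%E -> 0 <= r2 -> (r2%:E < R2)%E ->
  (forall q, K q -> r1 <= tau q p /\ sigma q p <= r2) -> laurent_abs_unif_cvg a p K.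
Proof.
move=> hr1 r20 hr2 hK; have r10 : 0 < r1 by rewrite -lte_fin (le_lt_trans R1_ge0).
have posM q n : K q -> `|laurent_pos a p q n| <= 2 * (`|a (Posz n)| * r2 ^+ n).
  move=> /hK[_ sq]; rewrite /laurent_pos /laurent_term qnormM /= mulrCA [leLHS]mulrC.
  rewrite ler_wpM2l // (le_trans (star_pow_nat_le q p n)) // ler_wpM2l //.
  by rewrite lerXn2r ?nnegrE ?sigma_ge0.
(* [Negz n] carries the power [n.+1]; the extra factor [r1^-1] goes into the constant. *)
have negM q n : K q ->
    `|laurent_neg a p q n| <= 2 / r1 * (`|a (Negz n)| * r1^-1 ^+ n).
  move=> /hK[tq _]; have t0 : 0 < tau q p by exact: lt_le_trans tq.
  rewrite /laurent_neg /laurent_term qnormM /= [leRHS]mulrCA [leLHS]mulrC.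
  rewrite ler_wpM2l // (le_trans (star_pow_neg_le n.+1 t0)) // -mulrA -exprS exprVn.
  by rewrite ler_wpM2l // lef_pV2 ?posrE ?exprn_gt0 // lerXn2r ?nnegrE ?(ltW t0) ?(ltW r10).
have posC : cvgn (series (fun n => 2 * (`|a (Posz n)| * r2 ^+ n))) :=
  @is_cvg_seriesZ _ _ 2 (pos_coef_cvg r20 hr2).
have negC : cvgn (series (fun n => 2 / r1 * (`|a (Negz n)| * r1^-1 ^+ n))) :=
  @is_cvg_seriesZ _ _ (2 / r1) (neg_coef_cvg hr1).
split; last first.
  by split; [exact: (weierstrass_M_test (fun n q => @posM q n) posC)
            |exact: (weierstrass_M_test (fun n q => @negM q n) negC)].
move=> q Kq; split.
- rewrite (_ : laurent_undefined a p q = set0); first exact: finite_set0.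
  rewrite -subset0 => m [].
  have [tq _] := hK q Kq.
  by case; apply: star_neg_defined_tau; exact: lt_le_trans tq.
- by apply: majorized_series_normed_cvg posC => n; exact: posM.
- by apply: majorized_series_normed_cvg negC => n; exact: negM.
Qed.

Lemma series_term_near (u : nat -> quat R) : cvgn (series u) -> \forall n \near \oo, `|u n| <= 1.
Proof. by move=> /cvg_series_cvg_0/cvgr0_norm_le; apply. Qed.

Lemma divergence_outside q : ~ Sigma_cball p R2 q -> ~ laurent_cvg a p q.
Proof.
rewrite /Sigma_cball /= => /negP; rewrite -ltNge => hq [_ /series_term_near[N1 _ h1] _].
have s0 : 0 < sigma q p by rewrite -lte_fin (le_lt_trans R2_ge0).
have [c c0 [N2 _ h2]] := star_pow_nat_ge s0.
have hL : ((sigma q p)^-1%:E < limn_esup (fun n : nat => (`|a n%:Z| `^ n%:R^-1)%:E))%E.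
  by rewrite -R2E inve_pgt ?inE ?lee_fin ?invr_ge0 ?(ltW s0) // inver gt_eqF ?invr_gt0 // invrK.
have is0 : 0 < (sigma q p)^-1 by rewrite invr_gt0.
(* The constant [c^-1] makes the lower bound of the term exceed 1, while the terms of a convergent
   series are eventually at most 1. *)
have [n] := @root_limsup_unbounded _ (fun n => a n%:Z) _ is0 hL c^-1 (maxn N1 N2).
rewrite geq_max => /andP[n1 n2] /= an.
have := h1 n n1; rewrite /laurent_pos /laurent_term qnormM; apply/negP; rewrite -ltNge.
apply: lt_le_trans (_ : c * sigma q p ^+ n * `|a n| <= _); last by rewrite ler_wpM2r // h2.
rewrite -ltr_pdivrMl ?mulr_gt0 ?exprn_gt0 // mulr1 invfM.
by move: an; rewrite exprVn.
Qed.

Lemma tau_gt0_star_neg_defined q : star_neg_defined p q -> 0 < tau q p.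
Proof.
move=> [/sphere_dist_gt0 h|[h ->]]; first exact: lt_le_trans h (sphere_dist_le_tau q p).
have [I hI ep] := slice_decomposition p; rewrite ep qconj_slice // /tau asboolT; last first.
  exact: same_slice_refl_slice.
rewrite slice_pointB subrr norm_slice // expr0n /= add0r sqrtr_sqr normr_gt0.
by rewrite -opprD oppr_eq0 -mulr2n mulrn_eq0 /= normr_eq0; apply/eqP.
Qed.

Lemma divergence_inside q : T_ball p R1 q -> ~ laurent_cvg a p q.
Proof.
rewrite /T_ball /= => hq [fin _ /series_term_near[N1 _ h1]].
rewrite R1E in hq.
(* Where [tau] vanishes the negative powers are undefined, so convergence leaves only finitely many
   nonzero [a (Negz n)]; a positive upper limit produces one beyond all of them. *)
have [t0|t0] := ltP 0 (tau q p); last first.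
  have tE : tau q p = 0 by apply/eqP; rewrite eq_le t0 tau_ge0.
  have ndef : ~ star_neg_defined p q by move=> /tau_gt0_star_neg_defined; rewrite tE ltxx.
  have [s sE] := (finite_seqP _).1 fin.
  rewrite tE in hq.
  (* The [.+2] leaves [n] above the maximum after the shift from the exponent [n.+1] to [Negz n]. *)
  have [[//|n] Nn] := @root_limsup_gt _ (fun n => a (- n%:Z)) 0 (\max_(i <- s) i).+2 (lexx _) hq.
  rewrite expr0n /= -NegzE normr_gt0 => /eqP an.
  have : [set` s] n by rewrite -sE.
  rewrite /= => ns; have := @leq_bigmax_seq _ s xpredT id n ns isT.
  by apply/negP; rewrite -ltnNge.
have [c c0 [N2 _ h2]] := star_pow_neg_ge t0.
have [n] := @root_limsup_unbounded _ (fun n => a (- n%:Z)) _ t0 hq c^-1 (maxn N1 N2).+1.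
case: n => [//|n]; rewrite ltnS geq_max -NegzE => /andP[n1 n2] an.
have := h1 n n1; rewrite /laurent_neg /laurent_term qnormM; apply/negP; rewrite -ltNge.
apply: lt_le_trans (_ : c * (tau q p)^-1 ^+ n.+1 * `|a (Negz n)| <= _); last first.
  by rewrite ler_wpM2r // h2 //= leqW.
rewrite -ltr_pdivrMl ?mulr_gt0 ?exprn_gt0 ?invr_gt0 // mulr1 invfM.
by move: an; rewrite exprVn invrK.
Qed.

End LaurentConvergence.

(** * Compact subsets of the annuli *)

Section Compactness.
Variable R : realType.

(** Near each point [f] stays below some [s < L], and by compactness finitely many such [s] suffice;
    their maximum is still below [L]. *)
Lemma compact_sup_lt (X : topologicalType) (K : set X) (f : X -> R) (L : \bar R) (r0 : R) :
  compact K -> (r0%:E < L)%E ->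
  (forall x r, K x -> f x < r -> \forall y \near x, f y < r) ->
  (forall x, K x -> ((f x)%:E < L)%E) ->
  exists r, [/\ r0 <= r, (r%:E < L)%E & forall x, K x -> f x <= r].
Proof.
move=> /compact_near_coveringP cK r0L usc fL.
(* r tends to L from below along F *)
pose F := [set A : set R | exists r, [/\ r0 <= r, (r%:E < L)%E &
  forall s, r <= s -> (s%:E < L)%E -> A s]].
have FF : Filter F.
  split.
  - by exists r0.
  - move=> A B [r [r0r rL hA]] [s [r0s sL hB]]; exists (Num.max r s); split.
    + by rewrite le_max r0r.
    + by rewrite /Num.max; case: ifP.
    + by move=> t; rewrite ge_max => /andP[rt st] tL; split; [exact: hA|exact: hB].
  - by move=> A B AB [r [? ? h]]; exists r; split=> // s rs sL; exact/AB/h.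
have [r [r0r rL h]] : F (fun r => K `<=` (fun x => f x <= r)).
  apply: (cK R F (fun r x => f x <= r) FF) => x Kx; have [s fs sL] := ereal_between (fL x Kx).
  exists ([set y | f y < s], [set r | s <= r]) => /=.
    split; first exact: usc.
    exists (Num.max r0 s); split; first by rewrite le_max lexx.
      by rewrite /Num.max; case: ifP.
    by move=> t; rewrite ge_max => /andP[].
  by move=> [y r] [/= fy sr]; exact: le_trans (ltW fy) sr.
by exists r; split=> // x; exact: h.
Qed.

End Compactness.

(** * Continuity of the distances *)

Section DistanceContinuity.
Variable R : realType.
Implicit Types (I J p q z : quat R) (x y e : R).

Lemma norm_re_im q : `|q| = Num.sqrt (qre q ^+ 2 + `|qim q| ^+ 2).
Proof. by have [J hJ {1}->] := slice_decomposition q; rewrite norm_slice. Qed.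

Lemma qreB p q : qre (p - q) = qre p - qre q.
Proof. by []. Qed.

Lemma qimB p q : qim (p - q) = qim p - qim q.
Proof. by rewrite /qim qreB scalerBl !opprB addrACA [RHS]addrACA [- q - _]addrC. Qed.

Lemma sphere_dist_le_norm z q : sphere_dist z q <= `|z - q|.
Proof.
rewrite norm_re_im qreB qimB ler_wsqrtr // lerD2l -[leLHS]real_normK ?num_real //.
by rewrite lerXn2r ?nnegrE // ler_dist_dist.
Qed.

(** [sphere_dist] is the Euclidean distance between the points [(Re q, |Im q|)] of a half plane, and
    the map to this half plane is 1-Lipschitz; the slice of any [I] serves as a model. *)
Lemma sphere_dist_lipschitz z q p : `|sphere_dist z p - sphere_dist q p| <= `|z - q|.
Proof.
have [I hI] := imag_unit_exists R; rewrite /sphere_dist -!(norm_slice _ _ hI).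
rewrite (le_trans (ler_dist_dist _ _)) // slice_pointB norm_slice //.
rewrite (le_trans _ (sphere_dist_le_norm z q)) // le_eqVlt; apply/orP; left; apply/eqP.
by congr Num.sqrt; ring.
Qed.

(** The argument for [sphere_dist], with [p] replaced by the mirror image [(Re p, - |Im p|)]. *)
Lemma omega_lipschitz z q p : `|omega z p - omega q p| <= `|z - q|.
Proof.
have [I hI] := imag_unit_exists R; rewrite /omega -!(norm_slice _ _ hI).
rewrite (le_trans (ler_dist_dist _ _)) // slice_pointB norm_slice //.
rewrite (le_trans _ (sphere_dist_le_norm z q)) // le_eqVlt; apply/orP; left; apply/eqP.
by congr Num.sqrt; ring.
Qed.

Lemma same_slice_sym q p : same_slice q p -> same_slice p q.
Proof. by move=> [I hI [h1 h2]]; exists I. Qed.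

(** A non-real point lies on a single slice. *)
Lemma same_slice_trans z q p : qim z <> 0 -> same_slice z q -> same_slice z p -> same_slice q p.
Proof.
move=> z0 [I hI [[x [y ez]] qI]] [J hJ [[x' [y' ez']] [s [t ep]]]].
exists I => //; split=> //; exists s, (t / y' * y); rewrite ep /slice_point; congr (_ + _).
have e : y' *: J = y *: I by rewrite -(qim_slice x' y') // -ez' ez qim_slice.
have y'0 : y' != 0.
  by apply/eqP => y'0; apply: z0; rewrite ez' qim_slice // y'0 scale0r.
by rewrite -scalerA -e scalerA divfK.
Qed.

Lemma same_slice_real q p : qim q = 0 -> same_slice q p.
Proof.
have [J hJ ep] := slice_decomposition p; move=> q0; exists J => //; split.
  exists (qre q), 0; rewrite slice_point0; apply/eqP; rewrite -subr_eq0; exact/eqP.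
by exists (qre p), `|qim p|.
Qed.

Lemma real_distances q p : qim q = 0 -> [/\ sigma q p = `|q - p|, tau q p = `|q - p|,
  omega q p = `|q - p| & sphere_dist q p = `|q - p|].
Proof.
move=> q0; have ss := same_slice_real p q0.
rewrite /sigma /tau asboolT //; split=> //.
  by rewrite norm_re_im qreB qimB q0 /omega q0 normr0 add0r sub0r normrN.
by rewrite norm_re_im qreB qimB q0 /sphere_dist q0 normr0 !sub0r normrN sqrrN.
Qed.

(* Near a non-real point, the topology of [sigma] is that of the slice. *)
Lemma sigma_ball_same_slice q : exists2 d, 0 < d & forall z, sigma z q < d ->
  [/\ same_slice z q, `|z - q| = sigma z q & qim q <> 0 -> qim z <> 0].
Proof.
have [q0|/eqP q0] := eqVneq (qim q) 0.
  exists 1 => // z _; have ss := same_slice_sym (same_slice_real z q0).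
  by split=> //; rewrite /sigma asboolT.
exists `|qim q|; first by rewrite normr_gt0; exact/eqP.
move=> z; have [ss|ns] := pselect (same_slice z q).
  rewrite /sigma asboolT // => h; split=> // _ z0.
  have := le_lt_trans (sphere_dist_le_norm z q) h; apply/negP; rewrite -leNgt.
  rewrite /sphere_dist z0 normr0 sub0r sqrrN -[leLHS]normr_id -sqrtr_sqr ler_wsqrtr //.
  by rewrite lerDr sqr_ge0.
rewrite /sigma asboolF // => h; exfalso; move: h; apply/negP; rewrite -leNgt.
rewrite /omega -[leLHS]normr_id -sqrtr_sqr ler_wsqrtr //.
rewrite ler_wpDl ?sqr_ge0 // lerXn2r ?nnegrE ?addr_ge0 // lerDr //.
Qed.

(** Close to [q] in [sigma], all points lie on a slice with [q]. For a non-real [q] they share a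
    slice with [p] exactly when [q] does, so one formula applies to all; for a real [q] the formulas
    agree at [q] and each is Lipschitz. *)
Lemma sigma_tau_sigma_continuous q p e : 0 < e -> exists2 d, 0 < d & forall z, sigma z q < d ->
  `|sigma z p - sigma q p| < e /\ `|tau z p - tau q p| < e.
Proof.
move=> e0; have [d d0 hd] := sigma_ball_same_slice q; exists (Num.min d e).
  by rewrite lt_min d0.
move=> z; rewrite lt_min => /andP[zd]; have [ss <- nr] := hd z zd => ze.
suff [h1 h2] : `|sigma z p - sigma q p| <= `|z - q| /\ `|tau z p - tau q p| <= `|z - q|.
  by split; exact: le_lt_trans ze.
have tri : `| `|z - p| - `|q - p| | <= `|z - q|.
  by rewrite (le_trans (ler_dist_dist _ _)) // opprB addrA subrK.
have sd := sphere_dist_lipschitz z q p; have om := omega_lipschitz z q p.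
have [q0|/eqP q0] := eqVneq (qim q) 0.
  have [es et eo ed] := real_distances p q0; rewrite es et.
  rewrite eo in om; rewrite ed in sd; rewrite /sigma /tau.
  by case: ifP.
have [sq|nq] := pselect (same_slice q p); rewrite /sigma /tau.
  rewrite (asboolT sq) asboolT //; apply: (same_slice_trans q0) => //.
  exact: same_slice_sym.
rewrite (asboolF nq) asboolF // => sz; apply: nq.
exact: same_slice_trans (nr q0) ss sz.
Qed.

End DistanceContinuity.

(** * Uniform convergence on compact subsets *)

Section CompactConvergence.
Variables (R : realType) (a : int -> quat R) (R1 R2 : \bar R).
Hypothesis R1_ge0 : (0 <= R1)%E.
Hypothesis R2_ge0 : (0 <= R2)%E.
Hypothesis R1E : R1 = limn_esup (fun m : nat => (`|a (- m%:Z)| `^ m%:R^-1)%:E).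
Hypothesis R2E : (R2^-1)%E = limn_esup (fun n : nat => (`|a n%:Z| `^ n%:R^-1)%:E).
Variable p : quat R.
Implicit Types q z : quat R.

Lemma compact_annulus_bounds (X : topologicalType) (K : set X) (f g : X -> R) :
  compact K -> K !=set0 ->
  (forall x r, f x < r -> \forall y \near x, f y < r) ->
  (forall x r, r < g x -> \forall y \near x, r < g y) ->
  (forall x, 0 <= f x) ->
  (forall x, K x -> (R1 < (g x)%:E)%E /\ ((f x)%:E < R2)%E) ->
  exists r1 r2, [/\ (R1 < r1%:E)%E, 0 <= r2, (r2%:E < R2)%E &
    forall x, K x -> r1 <= g x /\ f x <= r2].
Proof.
move=> cK [x0 Kx0] uf lg f0 fg.
have fR2 : (0%:E < R2)%E by apply: le_lt_trans (fg x0 Kx0).2; rewrite lee_fin.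
have [||r2 [r20 r2R hr2]] := compact_sup_lt cK fR2 (f := f).
- by move=> x r _; exact: uf.
- by move=> x /fg[].
(* The bound from below for [g] is a bound from above for [- g] against [- R1]. *)
have gR1 : ((- g x0)%:E < - R1)%E by rewrite EFinN lteN2; exact: (fg x0 Kx0).1.
have [||r1 [_ r1R hr1]] := compact_sup_lt cK gR1 (f := fun x => - g x).
- by move=> x r _; rewrite ltrNl => /lg; apply: filterS => y; rewrite ltrNl.
- by move=> x /fg[h _]; rewrite EFinN lteN2.
exists (- r1), r2; split=> //; first by rewrite EFinN lteNr.
by move=> x Kx; split; [rewrite lerNl; exact: hr1|exact: hr2].
Qed.

(** A point of the slice of [J] is at distance at least [sphere_dist] from the centre of the disc,
    with equality on the half plane of the centre; every [q] lies on such a half plane for a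
    suitable [J]. *)
Lemma T_cballE (r : \bar R) q : T_cball p r q <-> ((sphere_dist q p)%:E <= r)%E.
Proof.
split=> [[J hJ [[x [y ->]] h]]|h].
  apply: le_trans h; rewrite lee_fin slice_pointB norm_slice // /sphere_dist.
  rewrite qre_slice // norm_qim_slice // ler_wsqrtr // lerD2l.
  have := ler_norm (y * `|qim p|); rewrite normrM normr_id.
  by have := real_normK (num_real y); lra.
have [J hJ eq] := slice_decomposition q; exists J => //; split.
  by exists (qre q), `|qim q|.
by rewrite {1}eq slice_pointB norm_slice.
Qed.

Lemma Omega_annulusE q : Omega_annulus p R1 R2 q <->
  (R1 < (sphere_dist q p)%:E)%E /\ ((omega q p)%:E < R2)%E.
Proof.
rewrite /Omega_annulus /setD /= T_cballE; split=> [[? /negP]|[? ?]].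
  by rewrite -ltNge.
by split=> //; apply/negP; rewrite -ltNge.
Qed.

(** The topology is given by its open sets, so the whole set of points with values within [e] is
    shown to be open, each point [q] of it using the slack [e - |f q - f x|]. *)
Lemma sigma_continuous (f : quat R -> R) :
  (forall q e, 0 < e -> exists2 d, 0 < d & forall z, sigma z q < d -> `|f z - f q| < e) ->
  forall (x : sigma_quat R) e, 0 < e -> \forall y \near x, `|f y - f x| < e.
Proof.
move=> fc x e e0; have : open_nbhs x [set y : sigma_quat R | `|f y - f x| < e].
  split; last by rewrite /= subrr normr0.
  move=> q /= fq; have ex : 0 < e - `|f q - f x| by rewrite subr_gt0.
  have [d d0 hd] := fc q _ ex; exists d => // z; rewrite /Sigma_ball /= lte_fin => /hd.
  have := ler_normD (f z - f q) (f q - f x); rewrite addrA subrK.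
  by move=> h1 h2; apply: le_lt_trans h1 _; rewrite -ltrBrDr.
exact: open_nbhs_nbhs.
Qed.

Lemma near_lt (X : topologicalType) (f : X -> R) :
  (forall x e, 0 < e -> \forall y \near x, `|f y - f x| < e) ->
  (forall x r, f x < r -> \forall y \near x, f y < r) /\
  (forall x r, r < f x -> \forall y \near x, r < f y).
Proof.
move=> fc; split=> x r fr.
  have := fc x (r - f x); rewrite subr_gt0 => /(_ fr); apply: filterS => y.
  by move=> /(le_lt_trans (ler_norm _)); rewrite ltrD2r.
have := fc x (f x - r); rewrite subr_gt0 => /(_ fr); apply: filterS => y.
by rewrite distrC => /(le_lt_trans (ler_norm _)); rewrite ltrD2l ltrN2.
Qed.

Lemma laurent_abs_unif_cvg_set0 : laurent_abs_unif_cvg a p set0.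
Proof. by split=> //; split; exact: cvg_uniform_set0. Qed.

Lemma compact_Sigma_annulus (K : set (sigma_quat R)) : compact K ->
  K `<=` Sigma_annulus p R1 R2 -> laurent_abs_unif_cvg a p K.
Proof.
move=> cK KS; have [->|/set0P K0] := eqVneq K set0; first exact: laurent_abs_unif_cvg_set0.
have [|us _] := @near_lt (sigma_quat R) (fun q => sigma q p).
  apply: sigma_continuous => q e e0.
  have [d d0 hd] := sigma_tau_sigma_continuous q p e0.
  by exists d => // z /hd[].
have [|_ ut] := @near_lt (sigma_quat R) (fun q => tau q p).
  apply: sigma_continuous => q e e0.
  have [d d0 hd] := sigma_tau_sigma_continuous q p e0.
  by exists d => // z /hd[].
have [r1 [r2 [R1r r20 rR2 hK]]] :=
  compact_annulus_bounds cK K0 us ut (fun x => sigma_ge0 _ _) KS.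
exact: (laurent_abs_unif_cvg_bounded R1_ge0 R2_ge0 R1E R2E R1r r20 rR2 hK).
Qed.

Lemma lipschitz_near (f : quat R -> R) : (forall z q, `|f z - f q| <= `|z - q|) ->
  forall (x : quat R) e, 0 < e -> \forall y \near x, `|f y - f x| < e.
Proof.
move=> fl x e e0; apply/nbhs_ballP; exists e => //= z.
by rewrite -ball_normE /= distrC => h; rewrite (le_lt_trans (fl _ _)).
Qed.

(** [omega] and [sphere_dist] are continuous for the Euclidean topology, and they bound [sigma] from
    above and [tau] from below. *)
Lemma compact_Omega_annulus (K : set (quat R)) : compact K ->
  K `<=` Omega_annulus p R1 R2 -> laurent_abs_unif_cvg a p K.
Proof.
move=> cK KO; have [->|/set0P K0] := eqVneq K set0; first exact: laurent_abs_unif_cvg_set0.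
have [uo _] := near_lt (lipschitz_near (fun z q => omega_lipschitz z q p)).
have [_ us] := near_lt (lipschitz_near (fun z q => sphere_dist_lipschitz z q p)).
have [|x Kx|r1 [r2 [R1r r20 rR2 hK]]] := compact_annulus_bounds cK K0 uo us.
- by move=> x; exact: sqrtr_ge0.
- exact/Omega_annulusE/KO.
apply: (laurent_abs_unif_cvg_bounded R1_ge0 R2_ge0 R1E R2E R1r r20 rR2) => q /hK[h1 h2].
by split; [exact: le_trans (sphere_dist_le_tau q p)|exact: le_trans (sigma_le_omega q p) _].
Qed.

Lemma open_Omega_annulus : open (Omega_annulus p R1 R2).
Proof.
have [uo _] := near_lt (lipschitz_near (fun z q => omega_lipschitz z q p)).
have [_ us] := near_lt (lipschitz_near (fun z q => sphere_dist_lipschitz z q p)).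
rewrite openE => q /Omega_annulusE[h1 h2].
have [s os sR2] := ereal_between h2; have [t [_ st R1t]] := ereal_between_r R1_ge0 h1.
rewrite /interior; near=> z; apply/Omega_annulusE; split.
  by apply: lt_trans R1t _; rewrite lte_fin; near: z; exact: us.
by apply: lt_trans sR2; rewrite lte_fin; near: z; exact: uo.
Unshelve. all: by end_near. Qed.

End CompactConvergence.

(** * Regularity of the sum *)

Section PowerEstimates.
Variable R : realType.
Implicit Types (X Y : quat R) (r s M : R).

(* [dpw] is a complex derivative of [pw] on each slice, with a uniform
   second-order remainder over the annulus D. *)
Definition diff_est (D : set R) (pw dpw : quat R -> quat R) M :=
  forall X Y, GRing.comm X Y -> D `|X| -> D `|Y| ->
    [/\ `|pw Y| <= M, `|dpw Y| <= M &
        `|pw X - pw Y - (X - Y) * dpw Y| <= M * `|X - Y| ^+ 2].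

Lemma norm_natmul q n : `|(q : quat R) *+ n| = `|q| *+ n.
Proof. by rewrite -scaler_nat normrZ ger0_norm // mulr_natl. Qed.

(** A recursion for the second-order Taylor remainder; the new term contains [X - Y] twice, which
    yields the quadratic bound. At [n = 0] the value of [n.-1] is harmless because the multiplicity
    is 0. *)
Lemma power_remainderS X Y n : GRing.comm X Y ->
  X ^+ n.+1 - Y ^+ n.+1 - (X - Y) * (Y ^+ n *+ n.+1) =
  X * (X ^+ n - Y ^+ n - (X - Y) * (Y ^+ n.-1 *+ n)) +
  (X - Y) * ((X - Y) * (Y ^+ n.-1 *+ n)).
Proof.
move=> XY; case: n => [|n] /=.
  by rewrite !expr0 !expr1 mulr1n !mulr0n !mulr0 mulr1 !subrr mulr0 addr0.
have YX : (X - Y) * Y = Y * (X - Y) by apply/esym/commrB => //; exact/esym.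
set G := Y ^+ n *+ n.+1.
have -> : Y ^+ n.+1 *+ n.+2 = Y ^+ n.+1 + Y * G by rewrite mulrS /G mulrnAr -exprS.
have -> : (X - Y) * (Y ^+ n.+1 + Y * G) = X * Y ^+ n.+1 - Y ^+ n.+2 +
    (X * ((X - Y) * G) - (X - Y) * ((X - Y) * G)).
  rewrite -[X * _ - (X - Y) * _]mulrBl subKr mulrDr mulrBl -exprS; congr (_ + _).
  by rewrite mulrA YX -mulrA.
rewrite !mulrBr -!exprS.
set u := X ^+ _; set v := Y ^+ _; set w := X * _; set t := X * _; set z := (X - Y) * _.
by rewrite opprD !opprB !addrA subrK addrAC.
Qed.

(** In [s ^+ n - r ^+ n], factored by [s - r], each of the [n] summands is at least [r ^+ n.-1]. The
    factor [n] of the derivative is thus traded for the larger radius [s]. *)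
Lemma natmul_exp_le r s n : 0 <= r -> r < s ->
  (r ^+ n.-1 *+ n) * (s - r) <= s ^+ n.
Proof.
move=> r0 rs; have s0 : 0 <= s by rewrite (le_trans r0) // ltW.
have d0 : 0 <= s - r by rewrite subr_ge0 ltW.
elim: n => [|n IH]; first by rewrite mulr0n mul0r expr0.
have -> : r ^+ n.+1.-1 *+ n.+1 = r * (r ^+ n.-1 *+ n) + r ^+ n.
  by case: n {IH} => [|n] /=; rewrite ?mulr0n ?mulr0 ?add0r // mulrnAr -exprS -mulrSr.
have h1 : r * (r ^+ n.-1 *+ n) * (s - r) <= r * s ^+ n by rewrite -mulrA ler_wpM2l.
have h2 : r ^+ n * (s - r) <= s ^+ n * (s - r).
  by rewrite ler_wpM2r // lerXn2r // ltW.
by rewrite exprS; lra.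
Qed.

(** Induction on the recursion: relative to [s ^+ n * |X - Y| ^+ 2], the first summand contributes
    [r] and the second [s - r], which add up to [s]. *)
Lemma power_remainder_le X Y r s n : GRing.comm X Y -> `|X| <= r -> `|Y| <= r -> r < s ->
  `|X ^+ n - Y ^+ n - (X - Y) * (Y ^+ n.-1 *+ n)| * (s - r) ^+ 2 <= s ^+ n * `|X - Y| ^+ 2.
Proof.
move=> XY Xr Yr rs; have r0 : 0 <= r by exact: le_trans Xr.
have s0 : 0 <= s by rewrite (le_trans r0) // ltW.
have d0 : 0 <= s - r by rewrite subr_ge0 ltW.
elim: n => [|n IH].
  by rewrite !expr0 mulr0n mulr0 subrr subr0 normr0 mul0r mul1r sqr_ge0.
rewrite power_remainderS //.
set E := X ^+ n - _ - _ in IH *; set G := Y ^+ n.-1 *+ n.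
have hG : `|G| * (s - r) <= s ^+ n.
  apply: le_trans (natmul_exp_le n r0 rs); rewrite ler_wpM2r // norm_natmul qnormX.
  by rewrite lerMn2r lerXn2r ?nnegrE ?orbT.
have h1 := ler_normD (X * E) ((X - Y) * ((X - Y) * G)).
rewrite !qnormM in h1.
have h2 : `|X| * `|E| * (s - r) ^+ 2 <= r * (s ^+ n * `|X - Y| ^+ 2).
  by rewrite -mulrA ler_pM // mulr_ge0 ?sqr_ge0.
have h3 : `|X - Y| * (`|X - Y| * `|G|) * (s - r) ^+ 2 <= `|X - Y| ^+ 2 * (s ^+ n * (s - r)).
  have -> : `|X - Y| * (`|X - Y| * `|G|) * (s - r) ^+ 2 =
            `|X - Y| ^+ 2 * (`|G| * (s - r) * (s - r)) by ring.
  by rewrite ler_wpM2l ?sqr_ge0 // ler_wpM2r.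
apply: le_trans (ler_wpM2r (sqr_ge0 (s - r)) h1) _.
rewrite mulrDl; apply: le_trans (lerD h2 h3) _.
have aux (d w : R) : r * (w * d ^+ 2) + d ^+ 2 * (w * (s - r)) = s * w * d ^+ 2 by ring.
by rewrite aux -exprS.
Qed.

Lemma diff_est_pos r s : 0 <= r -> r < s -> exists2 C, 0 <= C & forall n,
  diff_est [set t | t <= r] (fun X => X ^+ n) (fun X => X ^+ n.-1 *+ n) (C * s ^+ n).
Proof.
move=> r0 rs; have s0 : 0 < s by exact: le_lt_trans rs.
have d0 : 0 < s - r by rewrite subr_gt0.
have h1 : 0 <= (s - r)^-1 by rewrite invr_ge0 ltW.
have h2 : 0 <= (s - r) ^- 2 by rewrite invr_ge0 sqr_ge0.
(* One summand for each of the three bounds of [diff_est]. *)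
exists (1 + (s - r)^-1 + (s - r) ^- 2); first by lra.
move=> n X Y XY /= Xr Yr; have sn : 0 <= s ^+ n by rewrite exprn_ge0 // ltW.
split.
- rewrite qnormX; apply: le_trans (_ : s ^+ n <= _).
    by rewrite lerXn2r ?nnegrE ?(ltW s0) // (le_trans Yr) // ltW.
  by rewrite ler_peMl //; lra.
- apply: le_trans (_ : (s - r)^-1 * s ^+ n <= _); last by rewrite ler_wpM2r //; lra.
  rewrite ler_pdivlMl // mulrC; apply: le_trans (natmul_exp_le n r0 rs).
  by rewrite ler_wpM2r ?(ltW d0) // norm_natmul qnormX lerMn2r lerXn2r ?nnegrE ?orbT.
apply: le_trans (_ : (s - r) ^- 2 * s ^+ n * `|X - Y| ^+ 2 <= _); last first.
  by rewrite ler_wpM2r ?sqr_ge0 // ler_wpM2r //; lra.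
rewrite -mulrA ler_pdivlMl ?exprn_gt0 // mulrC; exact: power_remainder_le.
Qed.

Lemma subrVV X Y : X != 0 -> Y != 0 -> X^-1 - Y^-1 = - (X^-1 * (X - Y) * Y^-1).
Proof. by move=> X0 Y0; rewrite mulrBr mulrBl mulVr ?qunitE // mul1r mulrK ?qunitE // opprB. Qed.

(** Second-order remainder of the inverse, whose derivative is [- Y^-1 ^+ 2]. *)
Lemma inv_remainder X Y : GRing.comm X Y -> X != 0 -> Y != 0 ->
  X^-1 - Y^-1 + (X - Y) * Y^-1 ^+ 2 = (X - Y) * X^-1 * (X - Y) * Y^-1 ^+ 2.
Proof.
move=> XY X0 Y0.
have h : X^-1 * (X - Y) * Y^-1 = Y^-1 - X^-1.
  by apply/oppr_inj; rewrite -subrVV // opprB.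
have XYV : GRing.comm X^-1 Y^-1 by apply: commrV; exact/esym/commrV/esym.
have -> : (X - Y) * X^-1 * (X - Y) * Y^-1 ^+ 2 =
    (X - Y) * (X^-1 * (X - Y) * Y^-1) * Y^-1 by rewrite expr2 !mulrA.
rewrite h mulrBr [RHS]mulrBl expr2 mulrA.
have -> : (X - Y) * X^-1 * Y^-1 = Y^-1 - X^-1.
  by rewrite mulrBl mulrV // mulrBl mul1r -mulrA XYV mulVKr.
by rewrite opprB addrC.
Qed.

(** Chain rule: the power estimate is applied to the inverses, at the radii [r^-1 < s^-1], and
    combined with the remainder of the inversion itself. *)
Lemma diff_est_neg r s : 0 < s -> s < r -> exists2 C, 0 <= C & forall n,
  diff_est [set t | r <= t] (fun X => X ^- n.+1) (fun X => - (X ^- n.+2 *+ n.+1))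
    (C * s^-1 ^+ n).
Proof.
move=> s0 sr; have r0 : 0 < r by exact: lt_trans sr.
pose r' := r^-1; pose s' := s^-1.
have r'0 : 0 < r' by rewrite invr_gt0.
have rs' : r' < s' by rewrite ltf_pV2.
have s'0 : 0 < s' by rewrite invr_gt0.
have d0 : 0 < s' - r' by rewrite subr_gt0.
(* The summands bound, in this order, the value, the derivative, the inversion remainder times the
   derivative of the power, and the power remainder at the inverses. *)
pose C := 1 + r' ^+ 2 / (s' - r') + r' ^+ 3 / (s' - r') + r' ^+ 4 / (s' - r') ^+ 2.
have [c1 c2 c3] : [/\ 0 <= r' ^+ 2 / (s' - r'), 0 <= r' ^+ 3 / (s' - r') &
    0 <= r' ^+ 4 / (s' - r') ^+ 2].
  by split; rewrite divr_ge0 ?exprn_ge0 ?(ltW r'0) ?(ltW d0).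
have C0 : 0 <= C by rewrite /C; lra.
(* The exponent is [n.+1] while the majorant has [n], hence the extra factor [s']. *)
exists (C * s') => [|n X Y XY /= rX rY]; first by rewrite mulr_ge0 // ltW.
have sn : 0 <= s' ^+ n.+1 by rewrite exprn_ge0 // ltW.
have X0 : X != 0 by rewrite -normr_gt0 (lt_le_trans r0).
have Y0 : Y != 0 by rewrite -normr_gt0 (lt_le_trans r0).
have Xr : `|X^-1| <= r' by rewrite qnormV lef_pV2 ?posrE ?normr_gt0.
have Yr : `|Y^-1| <= r' by rewrite qnormV lef_pV2 ?posrE ?normr_gt0.
have G : `|Y^-1 ^+ n *+ n.+1| <= s' ^+ n.+1 / (s' - r').
  rewrite ler_pdivlMr //; apply: le_trans (natmul_exp_le n.+1 (ltW r'0) rs').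
  by rewrite ler_wpM2r ?(ltW d0) // norm_natmul qnormX lerMn2r lerXn2r ?nnegrE ?(ltW r'0) ?orbT.
rewrite -mulrA -exprS -/s' -!exprVn.
have -> : Y^-1 ^+ n.+2 *+ n.+1 = Y^-1 ^+ 2 * (Y^-1 ^+ n *+ n.+1).
  by rewrite mulrnAr -exprD.
split.
- rewrite qnormX; apply: le_trans (_ : s' ^+ n.+1 <= _).
    by rewrite lerXn2r ?nnegrE ?(ltW s'0) // (le_trans Yr) // ltW.
  by rewrite ler_peMl // /C; lra.
- rewrite normrN qnormM qnormX.
  apply: le_trans (_ : r' ^+ 2 * (s' ^+ n.+1 / (s' - r')) <= _).
    by rewrite ler_pM ?exprn_ge0 // lerXn2r ?nnegrE ?(ltW r'0).
  by rewrite [s' ^+ _ / _]mulrC mulrA ler_wpM2r // /C; lra.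
have XYV : GRing.comm X^-1 Y^-1.
  by apply: commrV; apply/esym/commrV/esym.
have E := power_remainder_le n.+1 XYV Xr Yr rs'.
rewrite -ler_pdivlMr ?exprn_gt0 //= in E.
rewrite mulrN opprK.
have -> : X^-1 ^+ n.+1 - Y^-1 ^+ n.+1 + (X - Y) * (Y^-1 ^+ 2 * (Y^-1 ^+ n *+ n.+1)) =
   X^-1 ^+ n.+1 - Y^-1 ^+ n.+1 - (X^-1 - Y^-1) * (Y^-1 ^+ n *+ n.+1) +
   (X - Y) * X^-1 * (X - Y) * Y^-1 ^+ 2 * (Y^-1 ^+ n *+ n.+1).
  by rewrite -inv_remainder // [(_ - _ + _) * _]mulrDl addrA subrK !mulrA.
apply: le_trans (ler_normD _ _) _.
have F : `|X^-1 - Y^-1| ^+ 2 <= r' ^+ 4 * `|X - Y| ^+ 2.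
  rewrite subrVV // normrN !qnormM !exprMn mulrAC ler_wpM2r ?sqr_ge0 //.
  by rewrite (exprD _ 2 2) ler_pM ?sqr_ge0 // lerXn2r ?nnegrE ?(ltW r'0).
have H : `|(X - Y) * X^-1 * (X - Y) * Y^-1 ^+ 2| <= r' ^+ 3 * `|X - Y| ^+ 2.
  have -> : r' ^+ 3 * `|X - Y| ^+ 2 = `|X - Y| * r' * `|X - Y| * r' ^+ 2.
    by rewrite exprS expr2 [`|X - Y| ^+ 2]expr2; ring.
  rewrite qnormM qnormX !qnormM ler_pM ?mulr_ge0 ?exprn_ge0 //.
    by rewrite ler_wpM2r // ler_wpM2l.
  by rewrite lerXn2r ?nnegrE ?(ltW r'0).
rewrite qnormM.
have T := ler_pM (normr_ge0 _) (normr_ge0 _) H G.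
have sd : 0 <= (s' - r') ^- 2 by rewrite invr_ge0 sqr_ge0.
have E' : `|X^-1 ^+ n.+1 - Y^-1 ^+ n.+1 - (X^-1 - Y^-1) * (Y^-1 ^+ n *+ n.+1)| <=
    s' ^+ n.+1 * (r' ^+ 4 * `|X - Y| ^+ 2) / (s' - r') ^+ 2.
  apply: (le_trans E); rewrite ler_wpM2r // ler_wpM2l //.
apply: le_trans (lerD E' T) _.
have -> : s' ^+ n.+1 * (r' ^+ 4 * `|X - Y| ^+ 2) / (s' - r') ^+ 2 +
  r' ^+ 3 * `|X - Y| ^+ 2 * (s' ^+ n.+1 / (s' - r')) =
  (r' ^+ 3 / (s' - r') + r' ^+ 4 / (s' - r') ^+ 2) * (s' ^+ n.+1 * `|X - Y| ^+ 2).
  by move: (s' ^+ n.+1) (`|X - Y|) ((s' - r')^-1) => u v w; ring.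
by rewrite -[leRHS]mulrA ler_wpM2r ?mulr_ge0 ?sqr_ge0 // /C; lra.
Qed.

End PowerEstimates.

(** * Termwise differentiation along a slice *)

Section SliceSeries.
Variable R : realType.
Implicit Types (J : quat R) (z : R * R).

Lemma cvg_qmull (T : Type) (F : set_system T) {FF : Filter F} (h l : quat R)
    (v : T -> quat R) :
  v @ F --> l -> (fun n => h * v n) @ F --> h * l.
Proof.
move=> vl; apply/cvgrPdist_lt => e e0.
have e1 : 0 < e / (`|h| + 1) by rewrite divr_gt0 // ltr_wpDl.
move/cvgrPdist_lt: vl => /(_ _ e1); apply: filterS => n.
rewrite -mulrBr qnormM ltr_pdivlMr ?ltr_wpDl // => hn.
by apply: le_lt_trans hn; rewrite mulrC ler_wpM2l // lerDl.
Qed.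

Variables (I J : quat R) (x0 y0 : R).
Hypothesis hI : imag_units I.
Hypothesis hJ : imag_units J.
Variables (D : set R) (pw dpw : nat -> quat R -> quat R) (b : nat -> quat R) (M : nat -> R).
Hypothesis est : forall n, diff_est D (pw n) (dpw n) (M n).
Hypothesis cM : cvgn (series (fun n => M n * `|b n|)).

(** The representation formula centred at [p], with the bases [z - p] and [conj z - p] on the slice
    of [I]; when [F] is a power it gives the corresponding regular power. *)
Definition slice_combination (F : quat R -> quat R) z : quat R :=
  rep I J * F (slice_point I (z.1 - x0) (z.2 - y0)) +
  rep (- I) J * F (slice_point I (z.1 - x0) (- z.2 - y0)).

Definition slice_domain : set (R * R) :=
  [set z | D `|slice_point I (z.1 - x0) (z.2 - y0)| /\
           D `|slice_point I (z.1 - x0) (- z.2 - y0)|].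

Let term n z := slice_combination (pw n) z * b n.
Let dterm n z := slice_combination (dpw n) z * b n.

Lemma norm_rep_combination_le (u v : quat R) m : `|u| <= m -> `|v| <= m ->
  `|rep I J * u + rep (- I) J * v| <= 2 * m.
Proof.
move=> um vm; have h1 := norm_rep_le1 hI hJ; have h2 := norm_rep_le1 (imag_unitN hI) hJ.
rewrite (le_trans (ler_normD _ _)) // !qnormM mulrDl !mul1r.
by apply: lerD; [apply: le_trans um|apply: le_trans vm]; rewrite ler_piMl.
Qed.

Lemma slice_term_le n z : slice_domain z -> `|term n z| <= 2 * (M n * `|b n|).
Proof.
move=> [h1 h2]; rewrite qnormM mulrA ler_wpM2r // norm_rep_combination_le //.
  by have [] := est n (commr_refl _) h1 h1.
by have [] := est n (commr_refl _) h2 h2.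
Qed.

Lemma slice_dterm_le n z : slice_domain z -> `|dterm n z| <= 2 * (M n * `|b n|).
Proof.
move=> [h1 h2]; rewrite qnormM mulrA ler_wpM2r // norm_rep_combination_le //.
  by have [] := est n (commr_refl _) h1 h1.
by have [] := est n (commr_refl _) h2 h2.
Qed.

Lemma slice_term_remainder n z z' : slice_domain z -> slice_domain z' ->
  let h := slice_point J (z'.1 - z.1) (z'.2 - z.2) in
  `|term n z' - term n z - h * dterm n z| <= 2 * (M n * `|b n|) * `|h| ^+ 2.
Proof.
move=> [h1 h2] [h1' h2'] /=; set h := slice_point J _ _.
rewrite /term /dterm mulrA -!mulrBl qnormM mulrA mulrAC ler_wpM2r //.
(* The increment [h] on the slice of [J] crosses the two coefficients as the increments of [z] and
   of its conjugate on the slice of [I]. *)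
have hp : h * rep I J = rep I J *
    (slice_point I (z'.1 - x0) (z'.2 - y0) - slice_point I (z.1 - x0) (z.2 - y0)).
  by rewrite slice_point_rep // slice_pointB; congr (_ * slice_point _ _ _); ring.
have hm : h * rep (- I) J = rep (- I) J *
    (slice_point I (z'.1 - x0) (- z'.2 - y0) - slice_point I (z.1 - x0) (- z.2 - y0)).
  by rewrite slice_point_repN // slice_pointB; congr (_ * slice_point _ _ _); ring.
have nh : `|slice_point I (z'.1 - x0) (z'.2 - y0) - slice_point I (z.1 - x0) (z.2 - y0)| = `|h|.
  by rewrite slice_pointB /h !norm_slice //; congr Num.sqrt; ring.
have nh' : `|slice_point I (z'.1 - x0) (- z'.2 - y0) -
    slice_point I (z.1 - x0) (- z.2 - y0)| = `|h|.
  by rewrite slice_pointB /h !norm_slice //; congr Num.sqrt; ring.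
have rearr (q1 q2 q3 q4 q5 q6 : quat R) :
    q1 + q2 - (q3 + q4) - (q5 + q6) = q1 - q3 - q5 + (q2 - q4 - q6).
  by rewrite (opprD q3) (addrACA q1) (opprD q5) [LHS]addrACA.
rewrite /slice_combination mulrDr !mulrA hp hm rearr -!mulrA -!mulrBr.
apply: norm_rep_combination_le.
  have [_ _] := est n (slice_point_comm _ _ _ _ hI) h1' h1.
  by rewrite nh.
have [_ _] := est n (slice_point_comm _ _ _ _ hI) h2' h2.
by rewrite nh'.
Qed.

(** Summing [slice_term_remainder] bounds the partial sums by those of the majorant, hence by its
    limit, and the bound passes to the limit. *)
Lemma slice_series_frechet z z' : slice_domain z -> slice_domain z' ->
  let h := slice_point J (z'.1 - z.1) (z'.2 - z.2) in
  `|limn (series (term ^~ z')) - limn (series (term ^~ z)) -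
     h * limn (series (dterm ^~ z))|
  <= limn (series (fun n => 2 * (M n * `|b n|))) * `|h| ^+ 2.
Proof.
move=> Vz Vz' /=; set h := slice_point J _ _.
have cM2 : cvgn (series (fun n => 2 * (M n * `|b n|))) := @is_cvg_seriesZ _ _ 2 cM.
have c1 := majorized_series_cvg (fun n => slice_term_le n Vz') cM2.
have c2 := majorized_series_cvg (fun n => slice_term_le n Vz) cM2.
have c3 := majorized_series_cvg (fun n => slice_dterm_le n Vz) cM2.
have c4 : (fun n => series (term ^~ z') n - series (term ^~ z) n - h * series (dterm ^~ z) n)
    @ \oo --> limn (series (term ^~ z')) - limn (series (term ^~ z)) -
              h * limn (series (dterm ^~ z)).
  by apply: cvgB; [exact: cvgB|exact: cvg_qmull].
have := @norm_lim_le _ _ _ (limn (series (fun n => 2 * (M n * `|b n|))) * `|h| ^+ 2) 0 c4.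
rewrite subr0; apply; near=> n.
rewrite subr0 /= /series /= mulr_sumr -!sumrB (le_trans (ler_norm_sum _ _ _)) //.
apply: le_trans (_ : series (fun n => 2 * (M n * `|b n|)) n * `|h| ^+ 2 <= _).
  rewrite /series /= mulr_suml; apply: ler_sum => k _; exact: slice_term_remainder.
rewrite ler_wpM2r ?sqr_ge0 //; apply: nondecreasing_cvgn_le => //.
apply: nondecreasing_series => k _ _; exact: le_trans (slice_term_le k Vz).
Unshelve. all: by end_near. Qed.

End SliceSeries.

(** * Continuous partial derivatives from a second-order estimate *)

Section SliceDerivative.
Variable R : realType.
Implicit Types (J : quat R) (z : R * R).

Lemma norm_slice_le J (z : R * R) : imag_units J -> `|slice_point J z.1 z.2| <= 2 * `|z|.
Proof.
move=> hJ; rewrite (le_trans (ler_normD _ _)) // !normrZ qnorm1 mulr1 norm_imag_unit // mulr1.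
by rewrite mulrDl !mul1r lerD // prod_normE le_max lexx ?orbT.
Qed.

Variables (J : quat R) (V : set (R * R)) (f g : R * R -> quat R) (C : R).
Hypothesis hJ : imag_units J.
Hypothesis oV : open V.
Hypothesis C0 : 0 <= C.
Hypothesis frechet : forall z z', V z -> V z' ->
  let h := slice_point J (z'.1 - z.1) (z'.2 - z.2) in
  `|f z' - f z - h * g z| <= C * `|h| ^+ 2.

(** At [z' = z + h v] the slice increment is [h w], so dividing the quadratic remainder by [h]
    leaves a term of order [|h|]. *)
Lemma slice_derivative_direction z v : V z ->
  (fun h : R => h^-1 *: (f (h *: v + z) - f z)) @ 0^' --> slice_point J v.1 v.2 * g z.
Proof.
move=> Vz; set w := slice_point J v.1 v.2.
have cont : (fun h : R => h *: v + z) @ 0^' --> z.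
  rewrite -[X in _ --> X]add0r -[X in X + _](scale0r v).
  apply: cvgD; last exact: cvg_cst.
  apply: cvgZr_tmp; exact: cvg_within.
have c0 : 0 < C * `|w| ^+ 2 + 1 by rewrite ltr_wpDl // mulr_ge0 // sqr_ge0.
apply/cvgrPdist_lt => e e0; near=> h.
have h0 : h != 0 by near: h; exact: nbhs_dnbhs_neq.
have Vh : V (h *: v + z).
  by near: h; apply: cont; exact: open_nbhs_nbhs.
have hd : `|h| < e / (C * `|w| ^+ 2 + 1).
  near: h; apply: dnbhs0_lt; exact: divr_gt0.
have := frechet Vz Vh => /=.
rewrite !addrK -slice_pointZ -/w -scalerAl normrZ => hf.
have -> : w * g z - h^-1 *: (f (h *: v + z) - f z) =
    - (h^-1 *: (f (h *: v + z) - f z - h *: (w * g z))).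
  by rewrite [in RHS]scalerBr scalerA mulVf // scale1r opprB.
rewrite normrN normrZ normfV ltr_pdivrMl ?normr_gt0 //.
apply: le_lt_trans hf _.
have -> : C * (`|h| * `|w|) ^+ 2 = `|h| * (`|h| * (C * `|w| ^+ 2)) by ring.
rewrite ltr_pM2l ?normr_gt0 //; move: hd; rewrite ltr_pdivlMr //; apply: le_lt_trans.
by rewrite ler_wpM2l // lerDl.
Unshelve. all: by end_near. Qed.

Lemma slice_derivable z v : V z -> derivable f z v /\ 'D_v f z = slice_point J v.1 v.2 * g z.
Proof.
move=> Vz; have h := @slice_derivative_direction z v Vz; split; first by apply/cvg_ex; eexists; exact: h.
by apply: cvg_lim h.
Qed.

(** In the sum of the estimates for [(z, z')] and [(z', z)] the values of [f] cancel, leaving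
    [h * (g z' - g z)] of norm at most [2 C |h| ^+ 2]. The other factor 2 compares [|h|] with the
    maximum norm of the pair. *)
Lemma slice_derivative_lipschitz z z' : V z -> V z' ->
  `|g z' - g z| <= 4 * C * `|z' - z|.
Proof.
move=> Vz Vz'; set h := slice_point J (z'.1 - z.1) (z'.2 - z.2).
have h1 := frechet Vz Vz'; have h2 := frechet Vz' Vz; rewrite /= -/h in h1 h2.
have hN : slice_point J (z.1 - z'.1) (z.2 - z'.2) = - h by rewrite slice_pointN !opprB.
rewrite hN normrN in h2.
have [zz|h0] := eqVneq h 0.
  have -> : z' = z.
    move: zz => /eqP; rewrite slice_point_eq0 // !subr_eq0 => /andP[/eqP e1 /eqP e2].
    by case: z z' e1 e2 {Vz Vz' h1 h2 h hN} => [? ?] [? ?] /= -> ->.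
  by rewrite !subrr !normr0 mulr0.
have nh : `|h| <= 2 * `|z' - z| by exact: (norm_slice_le (z' - z) hJ).
suff : `|h| * `|g z' - g z| <= `|h| * (2 * C * `|h|).
  rewrite ler_pM2l ?normr_gt0 // => /le_trans; apply.
  have := ler_wpM2l C0 nh; lra.
rewrite -qnormM.
have -> : h * (g z' - g z) = (f z' - f z - h * g z) + (f z - f z' - - h * g z').
  rewrite mulNr opprK mulrBr addrACA -(opprB (f z)) addNr add0r addrC.
  by [].
apply: le_trans (ler_normD _ _) _; have := lerD h1 h2; rewrite expr2; lra.
Qed.

Lemma slice_derivative_continuous z : V z -> {for z, continuous g}.
Proof.
move=> Vz; apply/cvgrPdist_lt => e e0.
have e1 : 0 < e / (4 * C + 1) by rewrite divr_gt0 // ltr_wpDl // mulr_ge0.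
have Vn : \forall z' \near z, V z' by exact: open_nbhs_nbhs.
have dn : \forall z' \near z, `|z - z'| < e / (4 * C + 1).
  by apply/nbhs_ballP; exists (e / (4 * C + 1)) => //= z'; rewrite -ball_normE.
near=> z'.
have Vz' : V z' by near: z'.
have hz : `|z - z'| < e / (4 * C + 1) by near: z'.
apply: le_lt_trans (slice_derivative_lipschitz Vz' Vz) _.
move: hz; rewrite ltr_pdivlMr ?ltr_wpDl ?mulr_ge0 // => hz.
apply: le_lt_trans hz; rewrite mulrC ler_wpM2l // lerDl //.
Unshelve. all: by end_near. Qed.

End SliceDerivative.

(** * Regularity of the Laurent sum on a slice *)

Section Regularity.
Variables (R : realType) (a : int -> quat R) (R1 R2 : \bar R).
Hypothesis R1_ge0 : (0 <= R1)%E.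
Hypothesis R2_ge0 : (0 <= R2)%E.
Hypothesis R1E : R1 = limn_esup (fun m : nat => (`|a (- m%:Z)| `^ m%:R^-1)%:E).
Hypothesis R2E : (R2^-1)%E = limn_esup (fun n : nat => (`|a n%:Z| `^ n%:R^-1)%:E).
Variables p J : quat R.
Hypothesis hJ : imag_units J.

Definition slice_annulus (r1 r2 : R) : set (R * R) :=
  [set z | r1 < sphere_dist (slice_point J z.1 z.2) p /\
           omega (slice_point J z.1 z.2) p < r2].

Lemma near_slice (f : quat R -> R) : (forall z q, `|f z - f q| <= `|z - q|) ->
  forall (x : R * R) e, 0 < e ->
    \forall y \near x, `|f (slice_point J y.1 y.2) - f (slice_point J x.1 x.2)| < e.
Proof.
move=> fl x e e0; apply/nbhs_ballP; exists (e / 2) => /=; first by rewrite divr_gt0.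
move=> y; rewrite -ball_normE /= distrC => h; apply: le_lt_trans (fl _ _) _.
rewrite slice_pointB; apply: le_lt_trans (norm_slice_le (y - x) hJ) _.
by rewrite mulrC -ltr_pdivlMr.
Qed.

Lemma open_slice_annulus r1 r2 : open (slice_annulus r1 r2).
Proof.
have [uo _] := near_lt (near_slice (fun z q => omega_lipschitz z q p)).
have [_ us] := near_lt (near_slice (fun z q => sphere_dist_lipschitz z q p)).
rewrite openE => z [h1 h2]; rewrite /interior; near=> y; split.
  by near: y; exact: us.
by near: y; exact: uo.
Unshelve. all: by end_near. Qed.

(** [same_slice_between] on the slice of [I]; the two outer distances ignore the imaginary unit, so
    [J] may replace [I] in them. *)
Lemma slice_domain_bounds I x y x0 y0 : imag_units I ->
  sphere_dist (slice_point J x y) (slice_point I x0 y0)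
    <= `|slice_point I (x - x0) (y - y0)|
    <= omega (slice_point J x y) (slice_point I x0 y0).
Proof.
move=> hI.
have := same_slice_between (slice_point I x y) (slice_point I x0 y0).
rewrite slice_pointB /sphere_dist /omega !qre_slice // !norm_qim_slice //.
by case=> // ns; exfalso; apply: ns; exact: same_slice_refl_slice.
Qed.

Lemma lim_series_ge0 (u : nat -> R) : cvgn (series u) -> (forall n, 0 <= u n) ->
  0 <= limn (series u).
Proof.
by move=> cu u0; apply: limr_ge => //; near=> n; exact: sumr_ge0.
Unshelve. all: by end_near. Qed.

Lemma frechet_add (h u u' g v v' k : quat R) (B C t : R) :
  `|u' - u - h * g| <= B * t -> `|v' - v - h * k| <= C * t ->
  `|u' + v' - (u + v) - h * (g + k)| <= (B + C) * t.
Proof.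
move=> h1 h2; have -> : u' + v' - (u + v) - h * (g + k) =
    (u' - u - h * g) + (v' - v - h * k).
  by rewrite (opprD u) (addrACA u') mulrDr (opprD (h * g)) [LHS]addrACA.
by rewrite mulrDl (le_trans (ler_normD _ _)) // lerD.
Qed.

Lemma laurent_sum_frechet r1 r2 : (R1 < r1%:E)%E -> 0 <= r2 -> (r2%:E < R2)%E ->
  exists g C, 0 <= C /\ forall z z', slice_annulus r1 r2 z -> slice_annulus r1 r2 z' ->
  let h := slice_point J (z'.1 - z.1) (z'.2 - z.2) in
  `|laurent_sum a p (slice_point J z'.1 z'.2) - laurent_sum a p (slice_point J z.1 z.2)
    - h * g z| <= C * `|h| ^+ 2.
Proof.
move=> R1r r20 rR2; have r10 : 0 < r1 by rewrite -lte_fin (le_lt_trans R1_ge0).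
have [I hI ep] := slice_decomposition p; pose x0 := qre p; pose y0 := `|qim p|.
(* The gaps from [r2] to [s] and from [t] to [r1] absorb the factors [n] of the derivatives, while
   the coefficients remain summable at [s] and [t]. *)
have [s rs sR2] := ereal_between rR2.
have [t [t0 tr R1t]] := ereal_between_r R1_ge0 R1r.
have s0 : 0 <= s by rewrite (le_trans r20) // ltW.
have [C1 C10 est1] := diff_est_pos r20 rs.
have [C2 C20 est2] := diff_est_neg t0 tr.
have cM1 : cvgn (series (fun n => C1 * s ^+ n * `|(a \o Posz) n|)).
  rewrite (_ : (fun n => _) = C1 *: (fun n => `|a (Posz n)| * s ^+ n)).
    exact: is_cvg_seriesZ (pos_coef_cvg R2_ge0 R2E s0 sR2).
  by apply/funext => n /=; rewrite -mulrA [s ^+ n * _]mulrC.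
have cM2 : cvgn (series (fun n => C2 * t^-1 ^+ n * `|(a \o Negz) n|)).
  rewrite (_ : (fun n => _) = C2 *: (fun n => `|a (Negz n)| * t^-1 ^+ n)).
    exact: is_cvg_seriesZ (neg_coef_cvg R1_ge0 R1E R1t).
  by apply/funext => n /=; rewrite -mulrA [t^-1 ^+ n * _]mulrC.
have dom z : slice_annulus r1 r2 z ->
    slice_domain I x0 y0 [set t | t <= r2] z /\ slice_domain I x0 y0 [set t | r1 <= t] z.
  rewrite /slice_annulus /= ep => -[h1 h2].
  have /andP[i1 i2] := slice_domain_bounds z.1 z.2 x0 y0 hI.
  (* The conjugate point has the same distances, so both bases of the representation lie in the
     domain. *)
  have := slice_domain_bounds z.1 (- z.2) x0 y0 hI.
  have sN : sphere_dist (slice_point J z.1 (- z.2)) (slice_point I x0 y0) =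
            sphere_dist (slice_point J z.1 z.2) (slice_point I x0 y0).
    by rewrite /sphere_dist !qre_slice // !norm_qim_slice // normrN.
  have oN : omega (slice_point J z.1 (- z.2)) (slice_point I x0 y0) =
            omega (slice_point J z.1 z.2) (slice_point I x0 y0).
    by rewrite /omega !qre_slice // !norm_qim_slice // normrN.
  rewrite sN oN => /andP[i3 i4].
  by split; split; rewrite /= ?(le_trans i2 (ltW h2)) ?(le_trans i4 (ltW h2))
    ?(le_trans (ltW h1) i1) ?(le_trans (ltW h1) i3).
pose f1 z := limn (series (fun n =>
  slice_combination I J x0 y0 (fun X => X ^+ n) z * (a \o Posz) n)).
pose f2 z := limn (series (fun n =>
  slice_combination I J x0 y0 (fun X => X ^- n.+1) z * (a \o Negz) n)).
have sumE z : slice_annulus r1 r2 z ->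
  laurent_sum a p (slice_point J z.1 z.2) = f1 z + f2 z.
  move=> [h1 h2]; have ns : ~ sphere_of p (slice_point J z.1 z.2).
    by apply/sphere_dist_gt0; exact: lt_trans h1.
  rewrite /laurent_sum; congr (limn (series _) + limn (series _)); apply/funext => n.
    by rewrite /laurent_pos /laurent_term /= ep star_pow_nat_slice.
  by rewrite /laurent_neg /laurent_term /= ep star_pow_neg_slice // -ep.
pose g1 z := limn (series (fun n =>
  slice_combination I J x0 y0 (fun X => X ^+ n.-1 *+ n) z * (a \o Posz) n)).
pose g2 z := limn (series (fun n =>
  slice_combination I J x0 y0 (fun X => - (X ^- n.+2 *+ n.+1)) z * (a \o Negz) n)).
pose K1 := limn (series (fun n => 2 * (C1 * s ^+ n * `|(a \o Posz) n|))).
pose K2 := limn (series (fun n => 2 * (C2 * t^-1 ^+ n * `|(a \o Negz) n|))).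
exists (fun z => g1 z + g2 z), (K1 + K2); split.
  by rewrite addr_ge0 // lim_series_ge0 // => [|n||n];
    [exact: is_cvg_seriesZ cM1|rewrite !mulr_ge0 ?exprn_ge0
    |exact: is_cvg_seriesZ cM2|rewrite !mulr_ge0 ?exprn_ge0 // invr_ge0 ltW].
move=> z z' Vz Vz' /=; set h := slice_point J _ _.
have [z1 z2] := dom z Vz; have [z1' z2'] := dom z' Vz'.
rewrite !sumE //; apply: frechet_add.
  exact: (slice_series_frechet hI hJ est1 cM1 z1 z1').
exact: (slice_series_frechet hI hJ est2 cM2 z2 z2').
Qed.

(** The radii are chosen between those of the given point and those of the annulus, so the constant
    [C] is only local. *)
Lemma laurent_sum_regular z : Omega_annulus p R1 R2 (slice_point J z.1 z.2) ->
  exists V g C, [/\ open V, V z, 0 <= C &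
   forall z z', V z -> V z' ->
     let h := slice_point J (z'.1 - z.1) (z'.2 - z.2) in
    `|laurent_sum a p (slice_point J z'.1 z'.2) - laurent_sum a p (slice_point J z.1 z.2)
    - h * g z| <= C * `|h| ^+ 2].
Proof.
move=> /Omega_annulusE[h1 h2].
have [r2 or2 rR2] := ereal_between h2; have [r1 [_ rs1 R1r]] := ereal_between_r R1_ge0 h1.
have r20 : 0 <= r2 by apply: le_trans (ltW or2); exact: sqrtr_ge0.
have [g [C [C0 hC]]] := laurent_sum_frechet R1r r20 rR2.
by exists (slice_annulus r1 r2), g, C; split=> //; exact: open_slice_annulus.
Qed.

End Regularity.

Theorem theorem5p12 (R : realType) (a : int -> quat R) (R1 R2 : \bar R)
  (R1_ge0 : (0 <= R1)%E) (R2_ge0 : (0 <= R2)%E)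
  (R1E : R1 = limn_esup (fun m : nat => (`|a (- m%:Z)| `^ m%:R^-1)%:E))
  (R2E : (R2^-1)%E = limn_esup (fun n : nat => (`|a n%:Z| `^ n%:R^-1)%:E))
  (p : quat R) :
  [/\ (forall K : set (sigma_quat R), compact K ->
         K `<=` Sigma_annulus p R1 R2 -> laurent_abs_unif_cvg a p K) /\
       (forall K : set (quat R), compact K ->
         K `<=` Omega_annulus p R1 R2 -> laurent_abs_unif_cvg a p K),
      forall q, T_ball p R1 q -> ~ laurent_cvg a p q,
      forall q, ~ Sigma_cball p R2 q -> ~ laurent_cvg a p q &
      Omega_annulus p R1 R2 !=set0 ->
        slice_regular (Omega_annulus p R1 R2) (laurent_sum a p)].
Proof.
split.
- split=> K cK.
    exact: (compact_Sigma_annulus R1_ge0 R2_ge0 R1E R2E cK).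
  exact: (compact_Omega_annulus R1_ge0 R2_ge0 R1E R2E cK).
- exact: divergence_inside.
- exact: divergence_outside.
move=> _; split; first exact: open_Omega_annulus.
move=> J hJ UI fI dx dy.
(* The formula is needed on a neighbourhood of [z], since continuity of a partial derivative at [z]
   involves its values nearby. *)
have loc z : UI z -> exists g, [/\ \forall y \near z,
   (forall v, derivable fI y v /\ 'D_v fI y = slice_point J v.1 v.2 * g y) &
   {for z, continuous g}].
  move=> Uz; have [V [g [C [oV Vz C0 hV]]]] := laurent_sum_regular R1_ge0 R2_ge0 R1E R2E hJ Uz.
  exists g; split; last exact: (slice_derivative_continuous hJ oV C0 hV Vz).
  have : \forall y \near z, V y by exact: open_nbhs_nbhs.
  by apply: filterS => y Vy v; exact: (slice_derivable oV C0 hV v Vy).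
have cont z v : UI z -> {for z, continuous ('D_v fI)}.
  move=> /loc[g [near_g cg]]; have [_ gz] := nbhs_singleton near_g v.
  have : (fun y => 'D_v fI y) @ z --> slice_point J v.1 v.2 * g z.
    have hc : (fun y => slice_point J v.1 v.2 * g y) @ z --> slice_point J v.1 v.2 * g z.
      exact: cvg_qmull cg.
    apply: cvg_trans hc.
    by apply: near_eq_cvg; apply: filterS near_g => y /(_ v)[_ ->].
  by rewrite -gz.
split=> z Uz.
- have [g [/nbhs_singleton near_g _]] := loc z Uz.
  by split; [case: (near_g (1, 0))|case: (near_g (0, 1))].
- by split; exact: cont.
- have [g [/nbhs_singleton near_g _]] := loc z Uz.
  have [_ ex] := near_g (1, 0); have [_ ey] := near_g (0, 1).
  (* The partial derivatives are [g z] and [J * g z], and [J * J = - 1] makes the Cauchy-Riemann sum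
     cancel. *)
  rewrite /dx /dy ex ey /= /slice_point !scale0r !scale1r addr0 add0r mul1r mulrA.
  by rewrite imag_unit_mul // mulN1r subrr scaler0.
Qed.
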